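(* Consider a functional PTS specification, its EPTS and its Dedukti encoding. Let $\Gamma,A$ satisfy $\Gamma\vdash A\ type$, and let $T=\mathbf U_A$ if $A$ is a top-sort and $T=\mathbf{El}_{s_A}[\![A]\!]$ otherwise (where $\Gamma\vdash A:s_A$). Then $[\![-]\!]$ and $\lfloor-\rfloor$ give a bijection $$\Lambda(\Gamma\vdash_{EPTS}\_:A)\simeq\Lambda_{NF}([\![\Gamma]\!]\vdash_{DK}\_:T)/\equiv_H .$$ Moreover $[\![-]\!]$ commutes with substitution ($[\![M]\!]\{[\![N]\!]/x\}=[\![M\{N/x\}]\!]$), for EPTS terms $M,N$ one has $M\hookrightarrow^*N$ iff $[\![M]\!]\hookrightarrow^*[\![N]\!]$, and every Dedukti term $M$ with $[\![\Gamma]\!]\vdash_{DK}M:T$ has a $\beta$-normal form.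
   Context: $\Lambda(\Gamma\vdash_{EPTS}\_:A)$ is the set of EPTS terms $M$ with $\Gamma\vdash M:A$; $\Lambda_{NF}([\![\Gamma]\!]\vdash_{DK}\_:T)$ is the set of $\beta$-normal Dedukti terms $M$ with $[\![\Gamma]\!]\vdash_{DK}M:T$. Functional PTS specification $(\mathcal S,\mathcal A,\mathcal R)$ ($\mathcal A$ functional, $\mathcal R$ functional in first two components); top-sort: no $(s,s')\in\mathcal A$. EPTS terms $x\mid s\mid\Pi_{s_1,s_2}(A,x.B)\mid\lambda_{s_1,s_2}(A,x.B,x.M)\mid@_{s_1,s_2}(A,x.B,M,N)$; reduction: context closure of $@_{s_1,s_2}(A,x.B,\lambda_{s_1,s_2}(A',x.B',x.M),N)\hookrightarrow M\{N/x\}$, $(s_1,s_2,s_3)\in\mathcal R$. EPTS typing: standard rules Empty, Decl, Conv, Var, Sort ($(s_1,s_2)\in\mathcal A$ gives $s_1:s_2$), and for $(s_1,s_2,s_3)\in\mathcal R$: Prod ($A:s_1$, $x:A\vdash B:s_2$ give $\Pi_{s_1,s_2}(A,x.B):s_3$), Abs (plus $x:A\vdash M:B$ gives $\lambda_{s_1,s_2}(A,x.B,x.M):\Pi_{s_1,s_2}(A,x.B)$), App ($A:s_1$, $x:A\vdash B:s_2$, $N:A$, $M:\Pi_{s_1,s_2}(A,x.B)$ give $@_{s_1,s_2}(A,x.B,M,N):B\{N/x\}$). $\Gamma\vdash A\ type$: $\Gamma\vdash A:s$ for some $s$, or $A$ a top-sort with $\Gamma$ well-formed. Dedukti theory $(\Sigma_{EPTS},\mathscr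 R_{EPTS})$: $\mathbf U_s:\mathtt{TYPE}$, $\mathbf{El}_s[A:\mathbf U_s]:\mathtt{TYPE}$; for $(s_1,s_2)\in\mathcal A$: $\mathbf u_{s_1}:\mathbf U_{s_2}$ and rule $\mathbf{El}_{s_2}\mathbf u_{s_1}\hookrightarrow\mathbf U_{s_1}$; for $(s_1,s_2,s_3)\in\mathcal R$: $\mathbf{Prod}_{s_1,s_2}[A:\mathbf U_{s_1};B:\mathbf{El}_{s_1}A\to\mathbf U_{s_2}]:\mathbf U_{s_3}$, $\mathbf{abs}_{s_1,s_2}[A;B;M:\Pi x:\mathbf{El}_{s_1}A.\mathbf{El}_{s_2}(Bx)]:\mathbf{El}_{s_3}(\mathbf{Prod}_{s_1,s_2}AB)$, $\mathbf{app}_{s_1,s_2}[A;B;M:\mathbf{El}_{s_3}(\mathbf{Prod}_{s_1,s_2}AB);N:\mathbf{El}_{s_1}A]:\mathbf{El}_{s_2}(BN)$, rule $\mathbf{app}_{s_1,s_2}AB(\mathbf{abs}_{s_1,s_2}A'B'M)N\hookrightarrow MN$; $\vdash_{DK}$ is Dedukti typing (λΠ-calculus with constants, conversion modulo $\beta$ and these rules). Translation $[\![-]\!]$: $x\mapsto x$, $s\mapsto\mathbf u_s$, $\Pi_{s_1,s_2}(A,x.B)\mapsto\mathbf{Prod}_{s_1,s_2}[\![A]\!](\lambda x:\mathbf{El}_{s_1}[\![A]\!].[\![B]\!])$, $\lambda_{s_1,s_2}(A,x.B,x.M)\mapsto\mathbf{abs}_{s_1,s_2}[\![A]\!](\lambda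 x:\mathbf{El}_{s_1}[\![A]\!].[\![B]\!])(\lambda x:\mathbf{El}_{s_1}[\![A]\!].[\![M]\!])$, $@_{s_1,s_2}(A,x.B,M,N)\mapsto\mathbf{app}_{s_1,s_2}[\![A]\!](\lambda x:\mathbf{El}_{s_1}[\![A]\!].[\![B]\!])[\![M]\!][\![N]\!]$; $[\![\Gamma,x:A]\!]=[\![\Gamma]\!],x:\mathbf{El}_{s_A}[\![A]\!]$. Invertible forms: $M::=x\mid\mathbf u_s\mid\mathbf{abs}_{s_1,s_2}A(\lambda x:T_1.B)(\lambda x:T_2.M)\mid(\lambda x:T.M)N\mid\mathbf{Prod}_{s_1,s_2}A(\lambda x:T_1.B)\mid\mathbf{app}_{s_1,s_2}A(\lambda x:T_1.B)MN$ ($T$'s arbitrary); inverse translation $\lfloor-\rfloor$: $\lfloor x\rfloor=x$, $\lfloor\mathbf u_s\rfloor=s$, $\lfloor(\lambda x:T.M)N\rfloor=\lfloor M\rfloor\{\lfloor N\rfloor/x\}$, and $\mathbf{Prod},\mathbf{abs},\mathbf{app}$ forms sent to $\Pi,\lambda,@$ with the same sort indices, ignoring the binder annotations $T$ and applying $\lfloor-\rfloor$ to the bodies. $\equiv_H$ is the equivalence generated by steps $C(\lambda x:A.P)\hookrightarrow C(\lambda x:A'.P)$ with $A\hookrightarrow A'$. *)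

(* Defs.v *)
From Stdlib Require Export List Arith Relations.
Export ListNotations.
Set Implicit Arguments.
Unset Strict Implicit.

(** * Pure type system specifications *)

Record pts : Type := Pts {
  sort : Type;
  ax : sort -> sort -> Prop;
  rl : sort -> sort -> sort -> Prop }.

Definition functional (P : pts) : Prop :=
  (forall s s1 s2 : sort P, ax s s1 -> ax s s2 -> s1 = s2) /\
  (forall s1 s2 s3 s3' : sort P, rl s1 s2 s3 -> rl s1 s2 s3' -> s3 = s3').

Definition top_sort (P : pts) (s : sort P) : Prop := forall s', ~ ax s s'.

(** * Binding

    Both calculi use de Bruijn indices, so that equality is equality up to
    alpha-conversion.  A context is a list whose head is the most recent
    declaration, and the type of a declaration lives in the tail. *)

Definition up_ren (r : nat -> nat) (x : nat) : nat :=
  match x with 0 => 0 | S y => S (r y) end.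

(** * EPTS *)

Section EptsSyntax.

Variable P : pts.

Inductive eterm : Type :=
| EVar (x : nat)
| ESort (s : sort P)
| EPi (s1 s2 : sort P) (A B : eterm)
| ELam (s1 s2 : sort P) (A B M : eterm)
| EApp (s1 s2 : sort P) (A B M N : eterm).

Fixpoint eren (r : nat -> nat) (t : eterm) : eterm :=
  match t with
  | EVar x => EVar (r x)
  | ESort s => ESort s
  | EPi s1 s2 A B => EPi s1 s2 (eren r A) (eren (up_ren r) B)
  | ELam s1 s2 A B M =>
      ELam s1 s2 (eren r A) (eren (up_ren r) B) (eren (up_ren r) M)
  | EApp s1 s2 A B M N =>
      EApp s1 s2 (eren r A) (eren (up_ren r) B) (eren r M) (eren r N)
  end.

Definition eup (f : nat -> eterm) (x : nat) : eterm :=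
  match x with 0 => EVar 0 | S y => eren S (f y) end.

Fixpoint einst (f : nat -> eterm) (t : eterm) : eterm :=
  match t with
  | EVar x => f x
  | ESort s => ESort s
  | EPi s1 s2 A B => EPi s1 s2 (einst f A) (einst (eup f) B)
  | ELam s1 s2 A B M =>
      ELam s1 s2 (einst f A) (einst (eup f) B) (einst (eup f) M)
  | EApp s1 s2 A B M N =>
      EApp s1 s2 (einst f A) (einst (eup f) B) (einst f M) (einst f N)
  end.

(** [esubst x N M] is M{N/x}: the variable with index [x] disappears, so the
    indices above [x] are decremented. *)
Definition esubst (x : nat) (N M : eterm) : eterm :=
  einst (fun y => match Nat.compare y x with
                  | Lt => EVar y
                  | Eq => N
                  | Gt => EVar (pred y)
                  end) M.

Inductive ered : eterm -> eterm -> Prop :=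
| ered_beta s1 s2 s3 A B A' B' M N :
    rl s1 s2 s3 ->
    ered (EApp s1 s2 A B (ELam s1 s2 A' B' M) N) (esubst 0 N M)
| ered_pi1 s1 s2 A A' B : ered A A' -> ered (EPi s1 s2 A B) (EPi s1 s2 A' B)
| ered_pi2 s1 s2 A B B' : ered B B' -> ered (EPi s1 s2 A B) (EPi s1 s2 A B')
| ered_lam1 s1 s2 A A' B M :
    ered A A' -> ered (ELam s1 s2 A B M) (ELam s1 s2 A' B M)
| ered_lam2 s1 s2 A B B' M :
    ered B B' -> ered (ELam s1 s2 A B M) (ELam s1 s2 A B' M)
| ered_lam3 s1 s2 A B M M' :
    ered M M' -> ered (ELam s1 s2 A B M) (ELam s1 s2 A B M')
| ered_app1 s1 s2 A A' B M N :
    ered A A' -> ered (EApp s1 s2 A B M N) (EApp s1 s2 A' B M N)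
| ered_app2 s1 s2 A B B' M N :
    ered B B' -> ered (EApp s1 s2 A B M N) (EApp s1 s2 A B' M N)
| ered_app3 s1 s2 A B M M' N :
    ered M M' -> ered (EApp s1 s2 A B M N) (EApp s1 s2 A B M' N)
| ered_app4 s1 s2 A B M N N' :
    ered N N' -> ered (EApp s1 s2 A B M N) (EApp s1 s2 A B M N').

Definition ereds : relation eterm := clos_refl_trans eterm ered.
Definition econv : relation eterm := clos_refl_sym_trans eterm ered.

Inductive ewf : list eterm -> Prop :=
| ewf_empty : ewf []
| ewf_decl G A s : etyp G A (ESort s) -> ewf (A :: G)

with etyp : list eterm -> eterm -> eterm -> Prop :=
| etyp_var G x A :
    ewf G -> nth_error G x = Some A -> etyp G (EVar x) (eren (Nat.add (S x)) A)
| etyp_sort G s1 s2 : ewf G -> ax s1 s2 -> etyp G (ESort s1) (ESort s2)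
| etyp_conv G M A B s :
    etyp G M A -> etyp G B (ESort s) -> econv A B -> etyp G M B
| etyp_prod G s1 s2 s3 A B :
    rl s1 s2 s3 ->
    etyp G A (ESort s1) -> etyp (A :: G) B (ESort s2) ->
    etyp G (EPi s1 s2 A B) (ESort s3)
| etyp_abs G s1 s2 s3 A B M :
    rl s1 s2 s3 ->
    etyp G A (ESort s1) -> etyp (A :: G) B (ESort s2) -> etyp (A :: G) M B ->
    etyp G (ELam s1 s2 A B M) (EPi s1 s2 A B)
| etyp_app G s1 s2 s3 A B M N :
    rl s1 s2 s3 ->
    etyp G A (ESort s1) -> etyp (A :: G) B (ESort s2) ->
    etyp G M (EPi s1 s2 A B) -> etyp G N A ->
    etyp G (EApp s1 s2 A B M N) (esubst 0 N B).

(** The judgment "G |- A type". *)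
Definition eistype (G : list eterm) (A : eterm) : Prop :=
  (exists s, etyp G A (ESort s)) \/
  (exists s, A = ESort s /\ top_sort s /\ ewf G).

End EptsSyntax.

Arguments EVar {P} x.
Arguments ESort {P} s.

(** * Dedukti over the theory of the encoding

    Dedukti constants always occur applied to their full arity; each constant
    of the signature is therefore a constructor [CU], [CEl], ... taking its
    arguments.  As Dedukti syntax presupposes no typing, constants exist for
    all sorts, but only those declared in the signature are typable and only
    the rules of the theory reduce. *)

Section DeduktiSyntax.

Variable P : pts.

Inductive dterm : Type :=
| DVar (x : nat)
| DType
| DKind
| DApp (M N : dterm)
| DLam (A M : dterm)
| DPi (A B : dterm)
| CU (s : sort P)
| CEl (s : sort P) (A : dterm)
| Cu (s : sort P)
| CProd (s1 s2 : sort P) (A B : dterm)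
| Cabs (s1 s2 : sort P) (A B M : dterm)
| Capp (s1 s2 : sort P) (A B M N : dterm).

Fixpoint dren (r : nat -> nat) (t : dterm) : dterm :=
  match t with
  | DVar x => DVar (r x)
  | DType => DType
  | DKind => DKind
  | DApp M N => DApp (dren r M) (dren r N)
  | DLam A M => DLam (dren r A) (dren (up_ren r) M)
  | DPi A B => DPi (dren r A) (dren (up_ren r) B)
  | CU s => CU s
  | CEl s A => CEl s (dren r A)
  | Cu s => Cu s
  | CProd s1 s2 A B => CProd s1 s2 (dren r A) (dren r B)
  | Cabs s1 s2 A B M => Cabs s1 s2 (dren r A) (dren r B) (dren r M)
  | Capp s1 s2 A B M N =>
      Capp s1 s2 (dren r A) (dren r B) (dren r M) (dren r N)
  end.

Definition dup (f : nat -> dterm) (x : nat) : dterm :=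
  match x with 0 => DVar 0 | S y => dren S (f y) end.

Fixpoint dinst (f : nat -> dterm) (t : dterm) : dterm :=
  match t with
  | DVar x => f x
  | DType => DType
  | DKind => DKind
  | DApp M N => DApp (dinst f M) (dinst f N)
  | DLam A M => DLam (dinst f A) (dinst (dup f) M)
  | DPi A B => DPi (dinst f A) (dinst (dup f) B)
  | CU s => CU s
  | CEl s A => CEl s (dinst f A)
  | Cu s => Cu s
  | CProd s1 s2 A B => CProd s1 s2 (dinst f A) (dinst f B)
  | Cabs s1 s2 A B M => Cabs s1 s2 (dinst f A) (dinst f B) (dinst f M)
  | Capp s1 s2 A B M N =>
      Capp s1 s2 (dinst f A) (dinst f B) (dinst f M) (dinst f N)
  end.

Definition dsubst (x : nat) (N M : dterm) : dterm :=
  dinst (fun y => match Nat.compare y x with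
                  | Lt => DVar y
                  | Eq => N
                  | Gt => DVar (pred y)
                  end) M.

Definition darrow (A B : dterm) : dterm := DPi A (dren S B).

Inductive dclos (R : relation dterm) : relation dterm :=
| dclos_root M N : R M N -> dclos R M N
| dclos_app1 M M' N : dclos R M M' -> dclos R (DApp M N) (DApp M' N)
| dclos_app2 M N N' : dclos R N N' -> dclos R (DApp M N) (DApp M N')
| dclos_lam1 A A' M : dclos R A A' -> dclos R (DLam A M) (DLam A' M)
| dclos_lam2 A M M' : dclos R M M' -> dclos R (DLam A M) (DLam A M')
| dclos_pi1 A A' B : dclos R A A' -> dclos R (DPi A B) (DPi A' B)
| dclos_pi2 A B B' : dclos R B B' -> dclos R (DPi A B) (DPi A B')
| dclos_El s A A' : dclos R A A' -> dclos R (CEl s A) (CEl s A')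
| dclos_Prod1 s1 s2 A A' B :
    dclos R A A' -> dclos R (CProd s1 s2 A B) (CProd s1 s2 A' B)
| dclos_Prod2 s1 s2 A B B' :
    dclos R B B' -> dclos R (CProd s1 s2 A B) (CProd s1 s2 A B')
| dclos_abs1 s1 s2 A A' B M :
    dclos R A A' -> dclos R (Cabs s1 s2 A B M) (Cabs s1 s2 A' B M)
| dclos_abs2 s1 s2 A B B' M :
    dclos R B B' -> dclos R (Cabs s1 s2 A B M) (Cabs s1 s2 A B' M)
| dclos_abs3 s1 s2 A B M M' :
    dclos R M M' -> dclos R (Cabs s1 s2 A B M) (Cabs s1 s2 A B M')
| dclos_capp1 s1 s2 A A' B M N :
    dclos R A A' -> dclos R (Capp s1 s2 A B M N) (Capp s1 s2 A' B M N)
| dclos_capp2 s1 s2 A B B' M N :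
    dclos R B B' -> dclos R (Capp s1 s2 A B M N) (Capp s1 s2 A B' M N)
| dclos_capp3 s1 s2 A B M M' N :
    dclos R M M' -> dclos R (Capp s1 s2 A B M N) (Capp s1 s2 A B M' N)
| dclos_capp4 s1 s2 A B M N N' :
    dclos R N N' -> dclos R (Capp s1 s2 A B M N) (Capp s1 s2 A B M N').

Inductive beta_root : relation dterm :=
| beta_root_intro A M N : beta_root (DApp (DLam A M) N) (dsubst 0 N M).

Inductive rule_root : relation dterm :=
| rule_El s1 s2 : ax s1 s2 -> rule_root (CEl s2 (Cu s1)) (CU s1)
| rule_app s1 s2 s3 A B A' B' M N :
    rl s1 s2 s3 ->
    rule_root (Capp s1 s2 A B (Cabs s1 s2 A' B' M) N) (DApp M N).

Definition dbeta : relation dterm := dclos beta_root.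
Definition dred : relation dterm := dclos (union _ beta_root rule_root).

Definition dbetas : relation dterm := clos_refl_trans dterm dbeta.
Definition dreds : relation dterm := clos_refl_trans dterm dred.
Definition dconv : relation dterm := clos_refl_sym_trans dterm dred.

Definition beta_normal (M : dterm) : Prop := forall N, ~ dbeta M N.

Inductive H_root : relation dterm :=
| H_root_intro A A' M : dred A A' -> H_root (DLam A M) (DLam A' M).

Definition H_equiv : relation dterm := clos_refl_sym_trans dterm (dclos H_root).

Definition dsort (t : dterm) : Prop := t = DType \/ t = DKind.

(** The rules [dtyp_U] to [dtyp_capp] are the instances, for the declarations
    c[D] : T of the signature, of the rule deriving G |- c Ms : T{Ms} from
    G |- Ms : D. *)
Inductive dwf : list dterm -> Prop :=
| dwf_empty : dwf []
| dwf_decl G A : dtyp G A DType -> dwf (A :: G)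

with dtyp : list dterm -> dterm -> dterm -> Prop :=
| dtyp_type G : dwf G -> dtyp G DType DKind
| dtyp_var G x A :
    dwf G -> nth_error G x = Some A -> dtyp G (DVar x) (dren (Nat.add (S x)) A)
| dtyp_conv G M A B s :
    dtyp G M A -> dsort s -> dtyp G B s -> dconv A B -> dtyp G M B
| dtyp_pi G A B s :
    dsort s -> dtyp G A DType -> dtyp (A :: G) B s -> dtyp G (DPi A B) s
| dtyp_lam G A B M s :
    dsort s -> dtyp G A DType -> dtyp (A :: G) B s -> dtyp (A :: G) M B ->
    dtyp G (DLam A M) (DPi A B)
| dtyp_app G A B M N :
    dtyp G M (DPi A B) -> dtyp G N A -> dtyp G (DApp M N) (dsubst 0 N B)
| dtyp_U G s : dwf G -> dtyp G (CU s) DType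
| dtyp_El G s A : dtyp G A (CU s) -> dtyp G (CEl s A) DType
| dtyp_u G s1 s2 : ax s1 s2 -> dwf G -> dtyp G (Cu s1) (CU s2)
| dtyp_Prod G s1 s2 s3 A B :
    rl s1 s2 s3 ->
    dtyp G A (CU s1) -> dtyp G B (darrow (CEl s1 A) (CU s2)) ->
    dtyp G (CProd s1 s2 A B) (CU s3)
| dtyp_abs G s1 s2 s3 A B M :
    rl s1 s2 s3 ->
    dtyp G A (CU s1) -> dtyp G B (darrow (CEl s1 A) (CU s2)) ->
    dtyp G M (DPi (CEl s1 A) (CEl s2 (DApp (dren S B) (DVar 0)))) ->
    dtyp G (Cabs s1 s2 A B M) (CEl s3 (CProd s1 s2 A B))
| dtyp_capp G s1 s2 s3 A B M N :
    rl s1 s2 s3 ->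
    dtyp G A (CU s1) -> dtyp G B (darrow (CEl s1 A) (CU s2)) ->
    dtyp G M (CEl s3 (CProd s1 s2 A B)) -> dtyp G N (CEl s1 A) ->
    dtyp G (Capp s1 s2 A B M N) (CEl s2 (DApp B N)).

End DeduktiSyntax.

Arguments DVar {P} x.
Arguments DType {P}.
Arguments DKind {P}.
Arguments CU {P} s.
Arguments Cu {P} s.

(** * The translations *)

Section Translations.

Variable P : pts.

Fixpoint trans (t : eterm P) : dterm P :=
  match t with
  | EVar x => DVar x
  | ESort s => Cu s
  | EPi s1 s2 A B => CProd s1 s2 (trans A) (DLam (CEl s1 (trans A)) (trans B))
  | ELam s1 s2 A B M =>
      Cabs s1 s2 (trans A) (DLam (CEl s1 (trans A)) (trans B))
        (DLam (CEl s1 (trans A)) (trans M))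
  | EApp s1 s2 A B M N =>
      Capp s1 s2 (trans A) (DLam (CEl s1 (trans A)) (trans B))
        (trans M) (trans N)
  end.

(** The translation of contexts, as a relation: the sort [s] of [A] in [G] is
    unique when the specification is functional, and exists when the context
    is well-formed (see [trans_ctx_total] below). *)
Inductive trans_ctx : list (eterm P) -> list (dterm P) -> Prop :=
| trans_ctx_nil : trans_ctx [] []
| trans_ctx_cons G D A s :
    trans_ctx G D -> etyp G A (ESort s) ->
    trans_ctx (A :: G) (CEl s (trans A) :: D).

(** [trans_type G A T]: [T] is the Dedukti type associated with [A] when
    "G |- A type".  The cases are exclusive, a top-sort having no type. *)
Inductive trans_type (G : list (eterm P)) : eterm P -> dterm P -> Prop :=
| trans_type_top s : top_sort s -> trans_type G (ESort s) (CU s)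
| trans_type_El A s :
    etyp G A (ESort s) -> trans_type G A (CEl s (trans A)).

Definition map2o (X Y Z : Type) (f : X -> Y -> Z) (x : option X) (y : option Y)
  : option Z :=
  match x, y with Some x, Some y => Some (f x y) | _, _ => None end.

Definition apo (X Y : Type) (f : option (X -> Y)) (x : option X) : option Y :=
  map2o (fun g a => g a) f x.

(** The inverse translation; [None] outside the grammar of invertible forms. *)
Fixpoint inv (t : dterm P) : option (eterm P) :=
  match t with
  | DVar x => Some (EVar x)
  | Cu s => Some (ESort s)
  | CProd s1 s2 A (DLam _ B) => map2o (EPi s1 s2) (inv A) (inv B)
  | Cabs s1 s2 A (DLam _ B) (DLam _ M) =>
      apo (map2o (ELam s1 s2) (inv A) (inv B)) (inv M)
  | Capp s1 s2 A (DLam _ B) M N =>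
      apo (apo (map2o (@EApp P s1 s2) (inv A) (inv B)) (inv M)) (inv N)
  | DApp (DLam _ M) N => map2o (esubst 0) (inv N) (inv M)
  | _ => None
  end.

Lemma trans_ctx_total (G : list (eterm P)) :
  ewf G -> exists D, trans_ctx G D.
Proof.
assert (typ_wf : forall H M A, @etyp P H M A -> ewf H).
{ intros H M A h; induction h; assumption. }
induction G as [|A G IH]; intros wf.
- exists []; constructor.
- inversion wf as [|G' A' s hA]; subst.
  destruct (IH (typ_wf _ _ _ hA)) as [D hD].
  exists (CEl s (trans A) :: D); constructor; assumption.
Qed.

Lemma trans_type_total (G : list (eterm P)) A :
  eistype G A -> exists T, trans_type G A T.
Proof.
intros [[s hs]|[s [-> [hs _]]]].
- exists (CEl s (trans A)); now constructor.
- exists (CU s); now constructor.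
Qed.

End Translations.

(** [f] and the partial function [g] induce mutually inverse bijections between
    the set [X] and the quotient of the set [Y] by the equivalence [E]. *)
Definition bijection_mod (T U : Type) (X : T -> Prop) (Y : U -> Prop)
    (E : relation U) (f : T -> U) (g : U -> option T) : Prop :=
  (forall x, X x -> Y (f x)) /\
  (forall y, Y y -> exists x, g y = Some x /\ X x) /\
  (forall y y', Y y -> Y y' -> E y y' -> g y = g y') /\
  (forall x, X x -> g (f x) = Some x) /\
  (forall y x, Y y -> g y = Some x -> E (f x) y).

(* Main.v *)
(** All the metatheory is done on the Dedukti side.  The rules of the theory are
    orthogonal to beta, hence reduction is confluent; injectivity of products,
    subject reduction and uniqueness of types follow.  A Dedukti reduction of an
    invertible term induces an EPTS reduction of its inverse, so that the
    translation reflects reduction and conversion, and no metatheory of EPTS is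
    needed.

    Preservation of typing is by induction on EPTS derivations; in the conversion
    rule, convertible types have the same sort by confluence, subject reduction
    and uniqueness of types in Dedukti.  Conversely, a beta-normal term whose type
    is convertible to [CU s] or [CEl s A], in a context of such types, cannot be an
    application, and its arguments of product type are abstractions: it is
    invertible, and generation yields an EPTS derivation.  The binder annotations
    are convertible to those of the translation, whence the quotient by H.

    Beta-normal forms exist because dependency-erasing typing into simple types is
    stable under conversion: the rules of the theory only identify types with the
    same erasure. *)

From Stdlib Require Import Lia.
Require Import Defs.
Set Implicit Arguments.
Unset Strict Implicit.

(** * Substitution *)

Section Substitution.

Variable P : pts.
Implicit Types (M N A B T : dterm P) (e : eterm P) (r : nat -> nat).

(** * Algebra of renamings and substitutions *)

(** With the identity as [f], this is substitution at index 0 in parallel form: the comparison of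
    indices in [dsubst] disappears and composition laws apply directly. *)
Definition scons (X : Type) (a : X) (f : nat -> X) (x : nat) : X :=
  match x with 0 => a | S y => f y end.

Lemma dup_ext (f g : nat -> dterm P) :
  (forall x, f x = g x) -> forall x, dup f x = dup g x.
Proof. intros h [|x]; simpl; [|rewrite h]; auto. Qed.

Lemma eup_ext (f g : nat -> eterm P) :
  (forall x, f x = g x) -> forall x, eup f x = eup g x.
Proof. intros h [|x]; simpl; [|rewrite h]; auto. Qed.

Lemma dinst_ext M :
  forall f g, (forall x, f x = g x) -> dinst f M = dinst g M.
Proof. induction M; simpl; intros; f_equal; auto using dup_ext. Qed.

Lemma einst_ext e :
  forall f g, (forall x, f x = g x) -> einst f e = einst g e.
Proof. induction e; simpl; intros; f_equal; auto using eup_ext. Qed.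

Lemma dinst_dren M :
  forall f r, dinst f (dren r M) = dinst (fun x => f (r x)) M.
Proof.
induction M; simpl; intros; f_equal; auto;
  rewrite IHM2; apply dinst_ext; intros [|y]; reflexivity.
Qed.

Lemma dren_dinst_var M r : dren r M = dinst (fun x => DVar (r x)) M.
Proof.
revert r; induction M; simpl; intros; f_equal; auto;
  rewrite IHM2; apply dinst_ext; intros [|y]; reflexivity.
Qed.

Lemma dren_dren M r r' : dren r' (dren r M) = dren (fun x => r' (r x)) M.
Proof. rewrite (dren_dinst_var (dren r M)), dinst_dren, dren_dinst_var; reflexivity. Qed.

Lemma dren_dinst M :
  forall f r, dren r (dinst f M) = dinst (fun x => dren r (f x)) M.
Proof.
induction M; simpl; intros; f_equal; auto;
  rewrite IHM2; apply dinst_ext; intros [|y]; simpl; auto;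
  rewrite !dren_dren; reflexivity.
Qed.

Lemma dinst_dinst M :
  forall f g, dinst g (dinst f M) = dinst (fun x => dinst g (f x)) M.
Proof.
induction M; simpl; intros; f_equal; auto;
  rewrite IHM2; apply dinst_ext; intros [|y]; simpl; auto;
  rewrite dinst_dren, dren_dinst; reflexivity.
Qed.

Lemma dinst_var M : dinst (@DVar P) M = M.
Proof.
assert (h : forall f, (forall x, f x = DVar x) -> dinst f M = M).
{ induction M; simpl; intros f hf; f_equal; auto;
    apply IHM2; intros [|y]; simpl; auto; rewrite hf; reflexivity. }
apply h; reflexivity.
Qed.

Lemma dsubst0E N M : dsubst 0 N M = dinst (scons N (@DVar P)) M.
Proof. apply dinst_ext; intros [|y]; reflexivity. Qed.

Lemma esubst0E (e e' : eterm P) : esubst 0 e e' = einst (scons e (@EVar P)) e'.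
Proof. apply einst_ext; intros [|y]; reflexivity. Qed.

Lemma dinst_dsubst0 f N M :
  dinst f (dsubst 0 N M) = dsubst 0 (dinst f N) (dinst (dup f) M).
Proof.
rewrite !dsubst0E, !dinst_dinst; apply dinst_ext; intros [|y]; simpl; auto.
rewrite dinst_dren; simpl; symmetry; apply dinst_var.
Qed.

Lemma dren_dsubst0 r N M :
  dren r (dsubst 0 N M) = dsubst 0 (dren r N) (dren (up_ren r) M).
Proof.
rewrite !(dren_dinst_var _ r), dinst_dsubst0; f_equal.
rewrite dren_dinst_var; apply dinst_ext; intros [|y]; reflexivity.
Qed.

Lemma dsubst0_dren N M : dsubst 0 N (dren S M) = M.
Proof. rewrite dsubst0E, dinst_dren; apply dinst_var. Qed.

(** A weakened abstraction applied to the fresh variable contracts to its own body. The signature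
    types families as [B x], so this redex is met when such a type is compared with a translated
    body. *)
Lemma dsubst0_up_ren M : dsubst 0 (DVar 0) (dren (up_ren S) M) = M.
Proof.
rewrite dsubst0E, dinst_dren, <- dinst_var.
apply dinst_ext; intros [|y]; reflexivity.
Qed.

Lemma dinst_dup_dren f M : dinst (dup f) (dren S M) = dren S (dinst f M).
Proof. rewrite dinst_dren, dren_dinst; reflexivity. Qed.

Lemma dren_up_ren_dren r M : dren (up_ren r) (dren S M) = dren S (dren r M).
Proof. rewrite !dren_dren; reflexivity. Qed.

(** * The translation and substitution *)

Lemma trans_ren e : forall r, trans (eren r e) = dren r (trans e).
Proof. induction e; simpl; intros; f_equal; auto; f_equal; auto; f_equal; auto. Qed.

Lemma trans_inst e :
  forall f, trans (einst f e) = dinst (fun x => trans (f x)) (trans e).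
Proof.
assert (hup : forall f x, trans (eup f x) = dup (fun y => trans (P := P) (f y)) x).
{ intros f [|x]; simpl; auto; apply trans_ren. }
induction e; simpl; intros; f_equal; auto; f_equal; auto;
  try (f_equal; auto; fail);
  match goal with IH : forall f, trans (einst f ?e) = _ |- trans (einst _ ?e) = _ =>
    rewrite IH; apply dinst_ext; auto end.
Qed.

Lemma trans_subst x (M N : eterm P) :
  dsubst x (trans N) (trans M) = trans (esubst x N M).
Proof.
unfold esubst; rewrite trans_inst; apply dinst_ext.
intros y; destruct (Nat.compare y x); reflexivity.
Qed.

Lemma inv_trans e : inv (trans e) = Some e.
Proof.
induction e; simpl; auto;
  repeat match goal with H : inv _ = Some _ |- _ => rewrite H; clear H end; reflexivity.
Qed.

(** Since [inv] is a left inverse of [trans], laws of EPTS substitution can be pulled back from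
    those already proved for Dedukti terms. *)
Lemma trans_inj (e e' : eterm P) : trans e = trans e' -> e = e'.
Proof. intros h; apply (f_equal (@inv P)) in h; rewrite !inv_trans in h; congruence. Qed.

Lemma einst_esubst0 f (e e' : eterm P) :
  einst f (esubst 0 e e') = esubst 0 (einst f e) (einst (eup f) e').
Proof.
apply trans_inj; rewrite <- trans_subst, !trans_inst, <- trans_subst, dinst_dsubst0.
f_equal; apply dinst_ext; intros [|y]; simpl; auto; symmetry; apply trans_ren.
Qed.

Lemma eren_einst e r : eren r e = einst (fun x => EVar (r x)) e.
Proof. apply trans_inj; rewrite trans_ren, trans_inst; apply dren_dinst_var. Qed.

End Substitution.
(** * Congruences *)

Section Congruences.

Variable P : pts.
Implicit Types (M N A B T : dterm P) (f g : nat -> dterm P).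

(** Shared by many-step reduction, conversion and [H_equiv], each being a closure of some
    [dclos R]. *)
Record congruence (E : relation (dterm P)) : Prop := {
  cg_refl M : E M M;
  cg_trans M N T : E M N -> E N T -> E M T;
  cg_app M M' N N' : E M M' -> E N N' -> E (DApp M N) (DApp M' N');
  cg_lam A A' M M' : E A A' -> E M M' -> E (DLam A M) (DLam A' M');
  cg_pi A A' B B' : E A A' -> E B B' -> E (DPi A B) (DPi A' B');
  cg_El s A A' : E A A' -> E (CEl s A) (CEl s A');
  cg_Prod s1 s2 A A' B B' :
    E A A' -> E B B' -> E (CProd s1 s2 A B) (CProd s1 s2 A' B');
  cg_abs s1 s2 A A' B B' M M' :
    E A A' -> E B B' -> E M M' -> E (Cabs s1 s2 A B M) (Cabs s1 s2 A' B' M');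
  cg_capp s1 s2 A A' B B' M M' N N' :
    E A A' -> E B B' -> E M M' -> E N N' ->
    E (Capp s1 s2 A B M N) (Capp s1 s2 A' B' M' N') }.

Lemma rt_map (X Y : Type) (R : relation X) (S : relation Y) (f : X -> Y) :
  (forall x y, R x y -> clos_refl_trans Y S (f x) (f y)) ->
  forall x y, clos_refl_trans X R x y -> clos_refl_trans Y S (f x) (f y).
Proof. intros h x y; induction 1; eauto using clos_refl_trans. Qed.

Lemma rst_map (X Y : Type) (R : relation X) (S : relation Y) (f : X -> Y) :
  (forall x y, R x y -> clos_refl_sym_trans Y S (f x) (f y)) ->
  forall x y, clos_refl_sym_trans X R x y -> clos_refl_sym_trans Y S (f x) (f y).
Proof. intros h x y; induction 1; eauto using clos_refl_sym_trans. Qed.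

Lemma rt_rst (X : Type) (R : relation X) x y :
  clos_refl_trans X R x y -> clos_refl_sym_trans X R x y.
Proof. induction 1; eauto using clos_refl_sym_trans. Qed.

Lemma congruence_intro (E : relation (dterm P)) :
  reflexive _ E -> transitive _ E ->
  (forall C : dterm P -> dterm P,
     (forall R M N, dclos R M N -> dclos R (C M) (C N)) ->
     forall M N, E M N -> E (C M) (C N)) ->
  congruence E.
Proof.
intros hr ht hC; constructor; intros.
- apply hr.
- eapply ht; eassumption.
- apply ht with (DApp M' N);
    [apply (hC (fun X => DApp X N)) | apply (hC (DApp M'))]; auto using dclos.
- apply ht with (DLam A' M);
    [apply (hC (fun X => DLam X M)) | apply (hC (DLam A'))]; auto using dclos.
- apply ht with (DPi A' B);
    [apply (hC (fun X => DPi X B)) | apply (hC (DPi A'))]; auto using dclos.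
- apply (hC (CEl s)); auto using dclos.
- apply ht with (CProd s1 s2 A' B);
    [apply (hC (fun X => CProd s1 s2 X B)) | apply (hC (CProd s1 s2 A'))];
    auto using dclos.
- apply ht with (Cabs s1 s2 A' B M); [|apply ht with (Cabs s1 s2 A' B' M)];
    [apply (hC (fun X => Cabs s1 s2 X B M)) | apply (hC (fun X => Cabs s1 s2 A' X M))
    | apply (hC (Cabs s1 s2 A' B'))]; auto using dclos.
- apply ht with (Capp s1 s2 A' B M N); [|apply ht with (Capp s1 s2 A' B' M N);
    [|apply ht with (Capp s1 s2 A' B' M' N)]];
    [apply (hC (fun X => Capp s1 s2 X B M N)) | apply (hC (fun X => Capp s1 s2 A' X M N))
    | apply (hC (fun X => Capp s1 s2 A' B' X N)) | apply (hC (Capp s1 s2 A' B' M'))];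
    auto using dclos.
Qed.

Lemma congruence_rt (R : relation (dterm P)) :
  congruence (clos_refl_trans _ (dclos R)).
Proof.
apply congruence_intro.
- intros M; apply rt_refl.
- intros M N T; apply rt_trans.
- intros C hC; apply rt_map; intros; apply rt_step, hC; assumption.
Qed.

Lemma congruence_rst (R : relation (dterm P)) :
  congruence (clos_refl_sym_trans _ (dclos R)).
Proof.
apply congruence_intro.
- intros M; apply rst_refl.
- intros M N T; apply rst_trans.
- intros C hC; apply rst_map; intros; apply rst_step, hC; assumption.
Qed.

Lemma dclos_inst (R : relation (dterm P)) :
  (forall f M N, R M N -> R (dinst f M) (dinst f N)) ->
  forall M N, dclos R M N -> forall f, dclos R (dinst f M) (dinst f N).
Proof. intros hR M N; induction 1; simpl; auto using dclos. Qed.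

Lemma congruence_inst (E : relation (dterm P)) :
  congruence E -> (forall M N, E M N -> E (dren S M) (dren S N)) ->
  forall M f g, (forall x, E (f x) (g x)) -> E (dinst f M) (dinst g M).
Proof.
intros cE hE.
assert (hup : forall f g, (forall x, E (f x) (g x)) -> forall x, E (dup f x) (dup g x)).
{ intros f g h [|x]; simpl; [apply (cg_refl cE) | apply hE, h]. }
induction M; simpl; intros; try apply (cg_refl cE); auto;
  [apply cg_app | apply cg_lam | apply cg_pi | apply cg_El | apply cg_Prod
  | apply cg_abs | apply cg_capp]; auto.
Qed.

(** * Stability of reduction and conversion under substitution *)

Lemma dred_inst M N : dred M N -> forall f, dred (dinst f M) (dinst f N).
Proof.
apply dclos_inst; intros f A B [h|h]; [left|right]; destruct h; simpl.
- rewrite dinst_dsubst0; constructor.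
- constructor; assumption.
- econstructor; eassumption.
Qed.

Lemma dconv_refl M : dconv M M.
Proof. apply rst_refl. Qed.

Lemma dconv_sym M N : dconv M N -> dconv N M.
Proof. apply rst_sym. Qed.

Lemma dconv_trans M N T : dconv M N -> dconv N T -> dconv M T.
Proof. apply rst_trans. Qed.

Lemma dconv_inst M N f : dconv M N -> dconv (dinst f M) (dinst f N).
Proof. apply (rst_map (f := dinst f)); intros; apply rst_step, dred_inst; assumption. Qed.

Lemma dconv_ren M N r : dconv M N -> dconv (dren r M) (dren r N).
Proof. rewrite !dren_dinst_var; apply dconv_inst. Qed.

Lemma dconv_subst M M' N N' :
  dconv M M' -> dconv N N' -> dconv (dsubst 0 N M) (dsubst 0 N' M').
Proof.
intros hM hN; rewrite !dsubst0E.
apply dconv_trans with (dinst (scons N (@DVar P)) M'); [apply dconv_inst; assumption|].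
apply (congruence_inst (congruence_rst _)).
- intros; apply dconv_ren; assumption.
- intros [|x]; [exact hN | apply rst_refl].
Qed.

Lemma dred_beta A M N : dred (DApp (DLam A M) N) (dsubst 0 N M).
Proof. constructor; left; constructor. Qed.

Lemma dconv_beta A M N : dconv (DApp (DLam A M) N) (dsubst 0 N M).
Proof. apply rst_step, dred_beta. Qed.

Lemma dconv_app M M' N N' :
  dconv M M' -> dconv N N' -> dconv (DApp M N) (DApp M' N').
Proof. apply congruence_rst. Qed.

Lemma dconv_pi A A' B B' : dconv A A' -> dconv B B' -> dconv (DPi A B) (DPi A' B').
Proof. apply congruence_rst. Qed.

Lemma dconv_El s A A' : dconv A A' -> dconv (CEl s A) (CEl s A').
Proof. apply congruence_rst. Qed.

Lemma dconv_Prod s1 s2 A A' B B' :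
  dconv A A' -> dconv B B' -> dconv (CProd s1 s2 A B) (CProd s1 s2 A' B').
Proof. apply congruence_rst. Qed.

Lemma dconv_El_u (s1 s2 : sort P) : ax s1 s2 -> dconv (CEl s2 (Cu s1)) (CU s1).
Proof. intros h; apply rst_step; constructor; right; constructor; assumption. Qed.

Lemma H_equiv_dconv M N : H_equiv M N -> dconv M N.
Proof.
apply (rst_map (f := fun x => x)); intros x y h; apply rst_step.
induction h as [M' N' []| | | | | | | | | | | | | | | |]; unfold dred in *; auto using dclos.
Qed.

(** An annotation can be changed along any conversion, because each of its steps is an [H_root] step
    at the enclosing abstraction and [H_equiv] is symmetric. *)
Lemma H_equiv_lam A A' M M' : dconv A A' -> H_equiv M M' -> H_equiv (DLam A M) (DLam A' M').
Proof.
intros hA hM; apply rst_trans with (DLam A' M).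
- revert hA; apply (rst_map (f := fun X => DLam X M)); intros.
  apply rst_step; constructor; constructor; assumption.
- apply (cg_lam (congruence_rst _)); [apply rst_refl | assumption].
Qed.

End Congruences.

(** * Reduction of invertible terms *)

Section Inversion.

Variable P : pts.
Implicit Types (M N A B T : dterm P) (e : eterm P).

(** The graph of [inv], which gives induction along the grammar. Beta redexes belong to it because
    the rule on [Capp] creates them: this class, unlike the image of [trans], is closed under
    reduction. *)
Inductive invertible : dterm P -> eterm P -> Prop :=
| invertible_var x : invertible (DVar x) (EVar x)
| invertible_u s : invertible (Cu s) (ESort s)
| invertible_Prod s1 s2 A a T B b :
    invertible A a -> invertible B b ->
    invertible (CProd s1 s2 A (DLam T B)) (EPi s1 s2 a b)
| invertible_abs s1 s2 A a T B b T' M m :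
    invertible A a -> invertible B b -> invertible M m ->
    invertible (Cabs s1 s2 A (DLam T B) (DLam T' M)) (ELam s1 s2 a b m)
| invertible_capp s1 s2 A a T B b M m N n :
    invertible A a -> invertible B b -> invertible M m -> invertible N n ->
    invertible (Capp s1 s2 A (DLam T B) M N) (EApp s1 s2 a b m n)
| invertible_app T M m N n :
    invertible M m -> invertible N n ->
    invertible (DApp (DLam T M) N) (esubst 0 n m).

Lemma invertible_inv M e : invertible M e -> inv M = Some e.
Proof.
induction 1; simpl; auto;
  repeat match goal with H : inv _ = Some _ |- _ => rewrite H; clear H end; reflexivity.
Qed.

Lemma invertible_trans e : invertible (trans e) e.
Proof. induction e; simpl; constructor; assumption. Qed.

Lemma invertible_ren M e : invertible M e -> forall r, invertible (dren r M) (eren r e).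
Proof.
induction 1; simpl; intros; try (constructor; auto; fail).
replace (eren r (esubst 0 n m)) with (esubst 0 (eren r n) (eren (up_ren r) m)).
- constructor; auto.
- rewrite !eren_einst, einst_esubst0; f_equal; apply einst_ext; intros [|y]; reflexivity.
Qed.

Lemma invertible_inst M e :
  invertible M e ->
  forall f g, (forall x, invertible (f x) (g x)) -> invertible (dinst f M) (einst g e).
Proof.
assert (hup : forall f g, (forall x, invertible (f x) (g x)) ->
                          forall x, invertible (dup f x) (eup g x)).
{ intros f g h [|x]; simpl; [constructor | apply invertible_ren; auto]. }
induction 1; simpl; intros; try (constructor; auto; fail); auto.
rewrite einst_esubst0; constructor; auto.
Qed.

(** * Closure properties of EPTS reduction *)

Record econgruence (E : relation (eterm P)) : Prop := {
  ecg_pi s1 s2 a a' b b' : E a a' -> E b b' -> E (EPi s1 s2 a b) (EPi s1 s2 a' b');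
  ecg_lam s1 s2 a a' b b' m m' :
    E a a' -> E b b' -> E m m' -> E (ELam s1 s2 a b m) (ELam s1 s2 a' b' m');
  ecg_app s1 s2 a a' b b' m m' n n' :
    E a a' -> E b b' -> E m m' -> E n n' ->
    E (EApp s1 s2 a b m n) (EApp s1 s2 a' b' m' n') }.

Lemma ereds_refl e : ereds e e.
Proof. apply rt_refl. Qed.

Lemma econgruence_ereds : econgruence (@ereds P).
Proof.
constructor; intros.
- apply rt_trans with (EPi s1 s2 a' b);
    [apply (rt_map (f := fun x => EPi s1 s2 x b)) with (2 := H) | apply rt_map with (2 := H0)];
    intros; apply rt_step; constructor; assumption.
- apply rt_trans with (ELam s1 s2 a' b m); [|apply rt_trans with (ELam s1 s2 a' b' m)];
    [apply (rt_map (f := fun x => ELam s1 s2 x b m)) with (2 := H)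
    |apply (rt_map (f := fun x => ELam s1 s2 a' x m)) with (2 := H0)
    |apply rt_map with (2 := H1)];
    intros; apply rt_step; constructor; assumption.
- apply rt_trans with (EApp s1 s2 a' b m n); [|apply rt_trans with (EApp s1 s2 a' b' m n);
    [|apply rt_trans with (EApp s1 s2 a' b' m' n)]];
    [apply (rt_map (f := fun x => EApp s1 s2 x b m n)) with (2 := H)
    |apply (rt_map (f := fun x => EApp s1 s2 a' x m n)) with (2 := H0)
    |apply (rt_map (f := fun x => EApp s1 s2 a' b' x n)) with (2 := H1)
    |apply rt_map with (2 := H2)];
    intros; apply rt_step; constructor; assumption.
Qed.

Lemma ered_inst e e' : ered e e' -> forall f, ered (einst f e) (einst f e').
Proof.
induction 1; simpl; intros; try (constructor; auto; fail).
rewrite einst_esubst0; econstructor; eassumption.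
Qed.

Lemma ereds_inst e : forall f g,
  (forall x, ereds (f x) (g x)) -> ereds (einst f e) (einst g e).
Proof.
assert (hup : forall f g : nat -> eterm P, (forall x, ereds (f x) (g x)) ->
                          forall x, ereds (eup f x) (eup g x)).
{ intros f g h [|x]; simpl; [apply rt_refl|].
  apply (rt_map (f := eren S)) with (2 := h x).
  intros; apply rt_step; rewrite !eren_einst; apply ered_inst; assumption. }
induction e; simpl; intros; auto using ereds_refl;
  [apply ecg_pi | apply ecg_lam | apply ecg_app]; auto using econgruence_ereds.
Qed.

Lemma ereds_subst m m' n n' :
  ereds m m' -> ereds n n' -> ereds (esubst 0 n m) (esubst (P := P) 0 n' m').
Proof.
intros hm hn; rewrite !esubst0E.
apply rt_trans with (einst (scons n (@EVar P)) m').
- apply (rt_map (f := einst (scons n (@EVar P)))) with (2 := hm).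
  intros; apply rt_step, ered_inst; assumption.
- apply ereds_inst; intros [|x]; simpl; auto; apply rt_refl.
Qed.

(** * Simulation of reduction between the two calculi *)

Ltac inv_dclos :=
  match goal with
  | H : union _ _ _ _ _ |- _ => destruct H
  | H : beta_root _ _ |- _ => inversion H; subst; clear H
  | H : rule_root _ _ |- _ => inversion H; subst; clear H
  | H : dclos _ (DLam _ _) _ |- _ => inversion H; subst; clear H
  | H : dclos _ (DVar _) _ |- _ => inversion H; subst; clear H
  | H : dclos _ (Cu _) _ |- _ => inversion H; subst; clear H
  end.

Ltac use_IH :=
  match goal with
  | IH : forall M', dred ?M M' -> _, H : dclos _ ?M _ |- _ =>
      destruct (IH _ H) as [? [? ?]]; clear IH
  end.

(** A step of the [Capp] rule becomes an EPTS beta step; a root Dedukti beta step or a step in a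
    binder annotation leaves the inverse unchanged. A step inside a redex may be duplicated or
    erased by the substitution that [inv] performs, hence [ereds] in the conclusion. *)
Lemma invertible_dred M e :
  invertible M e -> forall M', dred M M' -> exists e', invertible M' e' /\ ereds e e'.
Proof.
induction 1; intros Q hQ; inversion hQ; subst; repeat inv_dclos; try use_IH;
  try (eexists; split; [constructor; eassumption|];
       first [apply ecg_pi | apply ecg_lam | apply ecg_app | apply ereds_subst | idtac];
       eauto using econgruence_ereds, ereds_refl; fail).
(* The [Capp] rule at the root: an invertible [Cabs] carries an explicit abstraction, so the reduct
   is a beta redex, whose inverse is the contracted EPTS term. *)
- inversion H1; subst.
  eexists; split; [constructor; eassumption|].
  apply rt_step; econstructor; eassumption.
(* Beta at the root: [inv] has already carried out the substitution, so no EPTS step corresponds to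
   it. *)
- eexists; split; [|apply rt_refl].
  rewrite dsubst0E, esubst0E; apply invertible_inst; [assumption|].
  intros [|x]; simpl; [assumption | constructor].
Qed.

Lemma invertible_dreds M M' :
  dreds M M' -> forall e, invertible M e -> exists e', invertible M' e' /\ ereds e e'.
Proof.
intros h; apply clos_rt_rt1n in h; induction h as [M|M N M' h _ IH]; intros e he.
- exists e; split; [assumption | apply rt_refl].
- destruct (invertible_dred he h) as [e1 [h1 r1]].
  destruct (IH _ h1) as [e2 [h2 r2]].
  exists e2; split; [assumption | eapply rt_trans; eassumption].
Qed.

(** A redex takes two Dedukti steps, the rule and then beta. A step in [A] is repeated in every
    binder annotation that copies [trans A]. *)
Lemma dreds_trans_ered e e' : ered e e' -> dreds (trans e) (trans e').
Proof.
assert (c := congruence_rt (union _ (@beta_root P) (@rule_root P))).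
assert (hr := cg_refl c).
induction 1; simpl.
- rewrite <- trans_subst.
  eapply rt_trans; apply rt_step; [constructor; right; econstructor; eassumption|].
  apply dred_beta.
- apply (cg_Prod c); [|apply (cg_lam c); [apply (cg_El c)|]]; auto.
- apply (cg_Prod c); [|apply (cg_lam c)]; auto.
- apply (cg_abs c); [|apply (cg_lam c); [apply (cg_El c)|]..]; auto.
- apply (cg_abs c); [|apply (cg_lam c)..]; auto.
- apply (cg_abs c); [|apply (cg_lam c)..]; auto.
- apply (cg_capp c); [|apply (cg_lam c); [apply (cg_El c)|]|..]; auto.
- apply (cg_capp c); [|apply (cg_lam c)|..]; auto.
- apply (cg_capp c); auto.
- apply (cg_capp c); auto.
Qed.

Lemma ereds_iff_dreds e e' : ereds e e' <-> dreds (trans e) (trans e').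
Proof.
split.
- apply rt_map, dreds_trans_ered.
- intros h; destruct (invertible_dreds h (invertible_trans e)) as [e2 [h2 r2]].
  apply invertible_inv in h2; rewrite inv_trans in h2; congruence.
Qed.

Lemma dconv_trans_econv e e' : econv e e' -> dconv (trans e) (trans e').
Proof. apply rst_map; intros; apply rt_rst, dreds_trans_ered; assumption. Qed.

(** * The inverse translation modulo H *)

Lemma inv_H_step M M' : dclos (@H_root P) M M' -> inv M = inv M'.
Proof.
(* A step in the second or third argument of a constant may happen under the
   abstraction that [inv] looks through, hence the second conjunct. *)
enough (h : dclos (@H_root P) M M' ->
  inv M = inv M' /\
  match M, M' with
  | DLam _ N, DLam _ N' => inv N = inv N'
  | DLam _ _, _ | _, DLam _ _ => False
  | _, _ => True
  end) by (intros; apply h; assumption).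
induction 1 as [M N []| | | | | | | | | | | | | | | |]; simpl; split; auto;
  repeat match goal with H : _ /\ _ |- _ => destruct H end;
  try match goal with H : inv _ = inv _ |- _ => rewrite H; reflexivity end;
  repeat match goal with
  | H : match ?M with _ => _ end |- _ => destruct M; simpl in *; try contradiction
  end; try congruence;
  match goal with H : inv _ = inv _ |- _ => rewrite H; reflexivity end.
Qed.

Lemma inv_H_equiv M M' : H_equiv M M' -> inv M = inv M'.
Proof. induction 1; auto using inv_H_step; congruence. Qed.

End Inversion.

(** * Confluence *)

Section Confluence.

Variable P : pts.
Implicit Types (M N A B T : dterm P).

(** * Parallel reduction *)

(** Parallel reduction in the style of Tait and Martin-Lof, contracting beta and theory redexes
    together; arguments discarded by a contraction are left alone. *)
Inductive dpar : dterm P -> dterm P -> Prop :=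
| dpar_var x : dpar (DVar x) (DVar x)
| dpar_type : dpar DType DType
| dpar_kind : dpar DKind DKind
| dpar_app M M' N N' : dpar M M' -> dpar N N' -> dpar (DApp M N) (DApp M' N')
| dpar_lam A A' M M' : dpar A A' -> dpar M M' -> dpar (DLam A M) (DLam A' M')
| dpar_pi A A' B B' : dpar A A' -> dpar B B' -> dpar (DPi A B) (DPi A' B')
| dpar_U s : dpar (CU s) (CU s)
| dpar_El s A A' : dpar A A' -> dpar (CEl s A) (CEl s A')
| dpar_u s : dpar (Cu s) (Cu s)
| dpar_Prod s1 s2 A A' B B' :
    dpar A A' -> dpar B B' -> dpar (CProd s1 s2 A B) (CProd s1 s2 A' B')
| dpar_abs s1 s2 A A' B B' M M' :
    dpar A A' -> dpar B B' -> dpar M M' ->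
    dpar (Cabs s1 s2 A B M) (Cabs s1 s2 A' B' M')
| dpar_capp s1 s2 A A' B B' M M' N N' :
    dpar A A' -> dpar B B' -> dpar M M' -> dpar N N' ->
    dpar (Capp s1 s2 A B M N) (Capp s1 s2 A' B' M' N')
| dpar_beta A M M' N N' :
    dpar M M' -> dpar N N' -> dpar (DApp (DLam A M) N) (dsubst 0 N' M')
| dpar_rule_El s1 s2 : ax s1 s2 -> dpar (CEl s2 (Cu s1)) (CU s1)
| dpar_rule_app s1 s2 s3 A B A' B' M M' N N' :
    rl s1 s2 s3 -> dpar M M' -> dpar N N' ->
    dpar (Capp s1 s2 A B (Cabs s1 s2 A' B' M) N) (DApp M' N').

Lemma dpar_refl M : dpar M M.
Proof. induction M; constructor; assumption. Qed.

Lemma dpar_dred M N : dred M N -> dpar M N.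
Proof.
induction 1 as [M N [h|h]| | | | | | | | | | | | | | | |];
  try (constructor; auto using dpar_refl; fail);
  destruct h; econstructor; eauto using dpar_refl.
Qed.

Lemma dreds_dpar M N : dpar M N -> dreds M N.
Proof.
assert (c := congruence_rt (union _ (@beta_root P) (@rule_root P))).
induction 1; try apply (cg_refl c);
  try (apply c; assumption).
- eapply (cg_trans c); [apply (cg_app c); [apply (cg_lam c); [apply (cg_refl c)|]|]; eassumption|].
  apply rt_step, dred_beta.
- apply rt_step; constructor; right; constructor; assumption.
- eapply (cg_trans c); [apply rt_step; constructor; right; econstructor; eassumption|].
  apply (cg_app c); assumption.
Qed.

Lemma dpar_ren M N : dpar M N -> forall r, dpar (dren r M) (dren r N).
Proof.
induction 1; simpl; intros; try (econstructor; eauto; fail).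
rewrite dren_dsubst0; constructor; auto.
Qed.

Lemma dpar_inst M N : dpar M N ->
  forall f g, (forall x, dpar (f x) (g x)) -> dpar (dinst f M) (dinst g N).
Proof.
assert (hup : forall f g, (forall x, dpar (f x) (g x)) -> forall x, dpar (dup f x) (dup g x)).
{ intros f g h [|x]; simpl; [constructor | apply dpar_ren; auto]. }
induction 1; simpl; intros; try (econstructor; eauto; fail); auto.
rewrite dinst_dsubst0; constructor; auto.
Qed.

Lemma dpar_subst M M' N N' :
  dpar M M' -> dpar N N' -> dpar (dsubst 0 N M) (dsubst 0 N' M').
Proof.
intros hM hN; rewrite !dsubst0E; apply dpar_inst; auto.
intros [|x]; simpl; auto using dpar_refl.
Qed.

Ltac dia :=
  match goal with
  | IH : forall N2, dpar ?M N2 -> exists N, dpar _ N /\ dpar N2 N, H : dpar ?M ?N |- _ =>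
      destruct (IH _ H) as [? [? ?]]; clear IH
  end.

(** Left-hand sides are linear and do not overlap, so a redex survives reduction of its parts: when
    only one side contracts it, the other still can. *)
Lemma dpar_diamond M N1 : dpar M N1 ->
  forall N2, dpar M N2 -> exists N, dpar N1 N /\ dpar N2 N.
Proof.
induction 1; intros Q hQ; inversion hQ; subst;
  try (repeat dia; eexists; split; econstructor; eassumption).
- inversion H; subst.
  (* The induction hypothesis speaks of the whole abstraction; its join is again an abstraction, and
     inverting it gives a join of the bodies. *)
  destruct (IHdpar1 (DLam A M'0)) as [Q [h1 h2]]; [constructor; auto using dpar_refl|].
  inversion h1; subst; inversion h2; subst.
  dia; eexists; split; [constructor; eassumption | apply dpar_subst; eassumption].
- inversion H; subst; eexists; split; [constructor; assumption | constructor].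
- inversion H1; subst.
  destruct (IHdpar3 (Cabs s1 s2 A'0 B'0 M'0)) as [Q [h1 h2]];
    [constructor; auto using dpar_refl|].
  inversion h1; subst; inversion h2; subst.
  dia; eexists; split; [econstructor; eassumption | constructor; eassumption].
- match goal with H : dpar (DLam _ _) _ |- _ => inversion H; subst end; repeat dia.
  eexists; split; [apply dpar_subst; eassumption | constructor; eassumption].
- repeat dia; eexists; split; apply dpar_subst; eassumption.
- match goal with H : dpar (Cu _) _ |- _ => inversion H; subst end; eexists; split; [constructor | constructor; assumption].
- match goal with H : dpar (Cabs _ _ _ _ _) _ |- _ => inversion H; subst end; repeat dia.
  eexists; split; [constructor; eassumption | econstructor; eassumption].
Qed.

(** * The Church-Rosser property *)

(** Diamonds tiled along one reduction: a parallel step contains every single step and is contained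
    in many-step reduction. *)
Lemma dpar_strip M N1 : dreds M N1 ->
  forall N2, dpar M N2 -> exists N, dpar N1 N /\ dreds N2 N.
Proof.
intros h; apply clos_rt_rt1n in h; induction h as [M|M M' N1 h _ IH]; intros N2 h2.
- exists N2; split; [assumption | apply rt_refl].
- destruct (dpar_diamond (dpar_dred h) h2) as [Q [h3 h4]].
  destruct (IH _ h3) as [N [h5 h6]]; exists N; split; [assumption|].
  eapply rt_trans; [apply dreds_dpar; eassumption | assumption].
Qed.

Lemma dreds_confluent M N1 N2 :
  dreds M N1 -> dreds M N2 -> exists N, dreds N1 N /\ dreds N2 N.
Proof.
intros h1 h2; revert N1 h1; apply clos_rt_rt1n in h2.
induction h2 as [M|M M' N2 h _ IH]; intros N1 h1.
- exists N1; split; [apply rt_refl | assumption].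
- destruct (dpar_strip h1 (dpar_dred h)) as [Q [h3 h4]].
  destruct (IH _ h4) as [N [h5 h6]]; exists N; split; [|assumption].
  eapply rt_trans; [apply dreds_dpar; eassumption | assumption].
Qed.

Lemma church_rosser M N : dconv M N -> exists Q, dreds M Q /\ dreds N Q.
Proof.
induction 1 as [M N h|M|M N _ [Q [h1 h2]]|M N T _ [Q1 [h1 h2]] _ [Q2 [h3 h4]]].
- exists N; split; [apply rt_step; assumption | apply rt_refl].
- exists M; split; apply rt_refl.
- exists Q; split; assumption.
- destruct (dreds_confluent h2 h3) as [Q [h5 h6]]; exists Q.
  split; eapply rt_trans; eassumption.
Qed.

(** A common reduct of the two translations is invertible, and its unique inverse is a common EPTS
    reduct. *)
Lemma econv_dconv_trans (e e' : eterm P) : dconv (trans e) (trans e') -> econv e e'.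
Proof.
intros h; destruct (church_rosser h) as [Q [h1 h2]].
destruct (invertible_dreds h1 (invertible_trans e)) as [q [i1 r1]].
destruct (invertible_dreds h2 (invertible_trans e')) as [q' [i2 r2]].
apply invertible_inv in i1; apply invertible_inv in i2.
replace q' with q in r2 by congruence.
apply rst_trans with q; [|apply rst_sym]; apply rt_rst; assumption.
Qed.

(** * Shapes of reducts and injectivity of constructors *)

Lemma dreds_ind_r (Q : dterm P -> Prop) M N :
  dreds M N -> Q M -> (forall X Y, Q X -> dred X Y -> Q Y) -> Q N.
Proof. intros h hM hs; induction h; eauto. Qed.

Ltac step_inv h := intros X Y h0 h; decompose record h0; subst;
  inversion h as [? ? [hb|hb]| | | | | | | | | | | | | | | |]; subst;
  try (inversion hb; subst).

Lemma dreds_kind Q : dreds DKind Q -> Q = DKind :> dterm P.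
Proof.
intros h; apply (dreds_ind_r (Q := fun X => X = DKind) h); auto.
step_inv hs.
Qed.

Lemma dreds_U (s : sort P) Q : dreds (CU s) Q -> Q = CU s.
Proof.
intros h; apply (dreds_ind_r (Q := fun X => X = CU s) h); auto.
step_inv hs.
Qed.

Lemma dreds_u (s : sort P) Q : dreds (Cu s) Q -> Q = Cu s.
Proof.
intros h; apply (dreds_ind_r (Q := fun X => X = Cu s) h); auto.
step_inv hs.
Qed.

Lemma dreds_pi A B Q : dreds (DPi A B) Q ->
  exists A' B', Q = DPi A' B' /\ dreds A A' /\ dreds B B'.
Proof.
intros h; apply (dreds_ind_r h (Q := fun X => exists A' B', X = DPi A' B' /\ dreds A A' /\ dreds B B')).
- do 2 eexists; repeat split; apply rt_refl.
- step_inv hs; do 2 eexists; repeat split; try eassumption;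
    (eapply rt_trans; [eassumption | apply rt_step; assumption]).
Qed.

Lemma dreds_Prod s1 s2 A B Q : dreds (CProd s1 s2 A B) Q ->
  exists A' B', Q = CProd s1 s2 A' B' /\ dreds A A' /\ dreds B B'.
Proof.
intros h; apply (dreds_ind_r h (Q := fun X => exists A' B', X = CProd s1 s2 A' B' /\ dreds A A' /\ dreds B B')).
- do 2 eexists; repeat split; apply rt_refl.
- step_inv hs; do 2 eexists; repeat split; try eassumption;
    (eapply rt_trans; [eassumption | apply rt_step; assumption]).
Qed.

(** The second alternative is the rule sending the code of a sort to its universe, for which [A]
    must first have reduced to that code. *)
Lemma dreds_El s A Q : dreds (CEl s A) Q ->
  (exists A', Q = CEl s A' /\ dreds A A') \/
  (exists s0, Q = CU s0 /\ ax s0 s /\ dreds A (Cu s0)).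
Proof.
intros h; apply (dreds_ind_r h (Q := fun X => (exists A', X = CEl s A' /\ dreds A A') \/
  (exists s0, X = CU s0 /\ ax s0 s /\ dreds A (Cu s0)))).
- left; eexists; split; [reflexivity | apply rt_refl].
- intros X Y [[A' [-> hA]]|[s0 [-> [hs hA]]]] h0;
    inversion h0 as [? ? [hb|hb]| | | | | | | | | | | | | | | |]; subst;
    try (inversion hb; subst).
  + right; eauto.
  + left; eexists; split; [reflexivity|].
    eapply rt_trans; [eassumption | apply rt_step; assumption].
Qed.

Lemma dconv_pi_inj A B A' B' : dconv (DPi A B) (DPi A' B') -> dconv A A' /\ dconv B B'.
Proof.
intros h; destruct (church_rosser h) as [Q [h1 h2]].
apply dreds_pi in h1; apply dreds_pi in h2.
destruct h1 as [A1 [B1 [-> [h1 h3]]]], h2 as [A2 [B2 [e [h2 h4]]]].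
inversion e; subst.
split; (eapply dconv_trans; [|apply dconv_sym]; apply rt_rst; eassumption).
Qed.

Lemma dconv_Prod_inj s1 s2 A B s1' s2' A' B' :
  dconv (CProd s1 s2 A B) (CProd s1' s2' A' B') -> dconv A A' /\ dconv B B'.
Proof.
intros h; destruct (church_rosser h) as [Q [h1 h2]].
apply dreds_Prod in h1; apply dreds_Prod in h2.
destruct h1 as [A1 [B1 [-> [h1 h3]]]], h2 as [A2 [B2 [e [h2 h4]]]].
inversion e; subst.
split; (eapply dconv_trans; [|apply dconv_sym]; apply rt_rst; eassumption).
Qed.

Lemma dconv_El_U s A s0 : dconv (CEl s A) (CU s0) -> ax s0 s /\ dreds A (Cu s0).
Proof.
intros h; destruct (church_rosser h) as [Q [h1 h2]]; apply dreds_U in h2; subst.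
destruct (dreds_El h1) as [[A' [e _]]|[s1 [e r]]]; inversion e; subst; assumption.
Qed.

Lemma dconv_U_inj (s s' : sort P) : dconv (CU s) (CU s') -> s = s'.
Proof.
intros h; destruct (church_rosser h) as [Q [h1 h2]].
apply dreds_U in h1; apply dreds_U in h2; congruence.
Qed.

(** When both sides have reached the same universe, both sorts are axiom types of its index, and
    functionality identifies them. *)
Lemma dconv_El_inj s A s' A' :
  functional P -> dconv (CEl s A) (CEl s' A') -> s = s' /\ dconv A A'.
Proof.
intros [hax _] h; destruct (church_rosser h) as [Q [h1 h2]].
destruct (dreds_El h1) as [[A1 [e1 r1]]|[s1 [e1 [a1 r1]]]],
  (dreds_El h2) as [[A2 [e2 r2]]|[s2 [e2 [a2 r2]]]]; subst; inversion e2; subst.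
- split; [reflexivity|].
  eapply dconv_trans; [|apply dconv_sym]; apply rt_rst; eassumption.
- split; [eapply hax; eassumption|].
  eapply dconv_trans; [|apply dconv_sym]; apply rt_rst; eassumption.
Qed.

(** * Heads of types, separating types that cannot be convertible *)

Inductive head : Type := HType | HKind | HPi | HU.

(* [CU] and [CEl] share a head because of the rule on [CEl s2 (Cu s1)]. *)
Definition type_head T : option head :=
  match T with
  | DType => Some HType
  | DKind => Some HKind
  | DPi _ _ => Some HPi
  | CU _ | CEl _ _ => Some HU
  | _ => None
  end.

Lemma dreds_type_head T T' h : dreds T T' -> type_head T = Some h -> type_head T' = Some h.
Proof.
intros hr; induction hr as [X Y hs| |]; auto.
intros hX; destruct X; simpl in hX; inversion hX; subst; 
  inversion hs as [? ? [hb|hb]| | | | | | | | | | | | | | | |]; subst;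
  try (inversion hb; subst); reflexivity.
Qed.

Lemma dconv_type_head T T' h h' :
  dconv T T' -> type_head T = Some h -> type_head T' = Some h' -> h = h'.
Proof.
intros hc h1 h2; destruct (church_rosser hc) as [Q [r1 r2]].
apply (dreds_type_head r1) in h1; apply (dreds_type_head r2) in h2; congruence.
Qed.

End Confluence.

Ltac no_conv :=
  match goal with
  | H : dconv _ _ |- _ =>
      assert (H' := dconv_type_head H eq_refl eq_refl); discriminate H'
  end.

(** * Metatheory of Dedukti typing *)

Section Typing.

Variable P : pts.
Implicit Types (M N A B T : dterm P) (G D : list (dterm P)).

(** * Typing under renaming, weakening and substitution *)

Lemma dtyp_wf G M T : dtyp G M T -> dwf G.
Proof. induction 1; assumption. Qed.

Lemma dsort_inst T f : dsort T -> dinst f T = T.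
Proof. intros [-> | ->]; reflexivity. Qed.

Lemma dsort_ren T r : dsort T -> dren r T = T.
Proof. intros [-> | ->]; reflexivity. Qed.

Lemma dren_add_S n A : dren (Nat.add (S n)) A = dren S (dren (Nat.add n) A).
Proof. rewrite dren_dren; reflexivity. Qed.

Definition ren_typed G D (r : nat -> nat) : Prop :=
  forall x A, nth_error G x = Some A ->
    exists A', nth_error D (r x) = Some A' /\
      dren (Nat.add (S (r x))) A' = dren r (dren (Nat.add (S x)) A).

Lemma ren_typed_up G D r A :
  ren_typed G D r -> ren_typed (A :: G) (dren r A :: D) (up_ren r).
Proof.
intros h [|x] A0; simpl.
- intros [= <-]; eexists; split; [reflexivity|].
  rewrite !dren_dren; reflexivity.
- intros hx; destruct (h _ _ hx) as [A' [h1 h2]]; exists A'; split; [assumption|].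
  rewrite (dren_add_S (S (r x))), h2, (dren_add_S (S x)), dren_up_ren_dren; reflexivity.
Qed.

Lemma dtyp_ren G M T : dtyp G M T ->
  forall D r, dwf D -> ren_typed G D r -> dtyp D (dren r M) (dren r T).
Proof.
induction 1; intros D r wf hr; simpl in *.
- constructor; assumption.
- destruct (hr _ _ H0) as [A' [h1 h2]]; simpl in h2; rewrite <- h2.
  constructor; assumption.
- apply dtyp_conv with (dren r A) s; auto using dconv_ren.
  rewrite <- (dsort_ren r H0); auto.
- rewrite (dsort_ren r H); apply dtyp_pi; [assumption|auto|].
  rewrite <- (dsort_ren (up_ren r) H).
  apply IHdtyp2; [econstructor; eauto | apply ren_typed_up; assumption].
- assert (wf' : dwf (dren r A :: D)) by (econstructor; eauto).
  assert (hr' : ren_typed (A :: G) (dren r A :: D) (up_ren r)) by (apply ren_typed_up; auto).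
  apply dtyp_lam with s; [assumption | apply IHdtyp1; assumption | | apply IHdtyp3; assumption].
  rewrite <- (dsort_ren (up_ren r) H); apply IHdtyp2; assumption.
- rewrite dren_dsubst0; eapply dtyp_app; eauto.
- apply dtyp_U; assumption.
- apply dtyp_El; auto.
- apply dtyp_u; auto.
- eapply dtyp_Prod; eauto.
- eapply dtyp_abs; eauto.
  rewrite <- dren_up_ren_dren; apply (IHdtyp3 _ _ wf hr).
- eapply dtyp_capp; eauto.
Qed.

Lemma dtyp_weaken G M T A :
  dtyp G M T -> dtyp G A DType -> dtyp (A :: G) (dren S M) (dren S T).
Proof.
intros hM hA; apply (dtyp_ren hM); [constructor; assumption|].
intros x B hx; exists B; split; [assumption|]; apply (dren_add_S (S x)).
Qed.

Lemma dtyp_lookup G : dwf G -> forall x A, nth_error G x = Some A ->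
  dtyp G (dren (Nat.add (S x)) A) DType.
Proof.
induction G as [|B G IH]; intros wf [|x] A hx; try discriminate;
  inversion wf; subst.
- injection hx as <-; apply (dtyp_weaken (T := DType)); assumption.
- rewrite dren_add_S; apply (dtyp_weaken (T := DType)); [|assumption].
  apply IH; [eapply dtyp_wf; eassumption | assumption].
Qed.

Definition inst_typed G D (f : nat -> dterm P) : Prop :=
  forall x A, nth_error G x = Some A -> dtyp D (f x) (dinst f (dren (Nat.add (S x)) A)).

Lemma inst_typed_up G D f A :
  inst_typed G D f -> dtyp D (dinst f A) DType ->
  inst_typed (A :: G) (dinst f A :: D) (dup f).
Proof.
intros h hA [|x] A0; simpl.
- intros [= <-]; change (Nat.add 1) with S; rewrite dinst_dup_dren.
  apply dtyp_var with (x := 0); [constructor; assumption | reflexivity].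
- intros hx; rewrite (dren_add_S (S x)), dinst_dup_dren.
  apply dtyp_weaken; auto.
Qed.

Lemma dtyp_inst G M T : dtyp G M T ->
  forall D f, dwf D -> inst_typed G D f -> dtyp D (dinst f M) (dinst f T).
Proof.
induction 1; intros D f wf hf; simpl in *.
- constructor; assumption.
- apply hf; assumption.
- apply dtyp_conv with (dinst f A) s; auto using dconv_inst.
  rewrite <- (dsort_inst f H0); auto.
- rewrite (dsort_inst f H); apply dtyp_pi; [assumption|auto|].
  rewrite <- (dsort_inst (dup f) H).
  apply IHdtyp2; [econstructor; eauto | apply inst_typed_up; auto].
- assert (wf' : dwf (dinst f A :: D)) by (econstructor; eauto).
  assert (hr' : inst_typed (A :: G) (dinst f A :: D) (dup f)) by (apply inst_typed_up; auto).
  apply dtyp_lam with s; [assumption | apply IHdtyp1; assumption | | apply IHdtyp3; assumption].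
  rewrite <- (dsort_inst (dup f) H); apply IHdtyp2; assumption.
- rewrite dinst_dsubst0; eapply dtyp_app; eauto.
- apply dtyp_U; assumption.
- apply dtyp_El; auto.
- apply dtyp_u; auto.
- eapply dtyp_Prod; eauto.
- eapply dtyp_abs; eauto.
  rewrite <- dinst_dup_dren; apply (IHdtyp3 _ _ wf hf).
- eapply dtyp_capp; eauto.
Qed.

Lemma dtyp_subst G A M T N :
  dtyp (A :: G) M T -> dtyp G N A -> dtyp G (dsubst 0 N M) (dsubst 0 N T).
Proof.
intros hM hN; rewrite !dsubst0E; apply (dtyp_inst hM); [eapply dtyp_wf; eassumption|].
intros [|x] B; simpl.
- intros [= <-]; rewrite dinst_dren; simpl.
  replace (dinst _ A) with A; [assumption | symmetry; apply dinst_var].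
- intros hx; rewrite dinst_dren; simpl; rewrite <- dren_dinst_var.
  apply dtyp_var; [eapply dtyp_wf|]; eassumption.
Qed.

(** Typing under substitution, applied to the identity: only variable 0 has a new declared type, and
    it recovers the old one by conversion. *)
Lemma dtyp_ctx_conv G A A' M T :
  dtyp (A :: G) M T -> dtyp G A' DType -> dconv A A' -> dtyp (A' :: G) M T.
Proof.
intros hM hA' hc.
assert (hA : dtyp G A DType) by (assert (wf := dtyp_wf hM); inversion wf; assumption).
rewrite <- (dinst_var M), <- (dinst_var T); apply (dtyp_inst hM); [constructor; assumption|].
intros [|x] B hx; rewrite dinst_var.
- injection hx as <-.
  apply dtyp_conv with (dren (Nat.add 1) A') DType.
  + constructor; [constructor; assumption | reflexivity].
  + left; reflexivity.
  + apply (dtyp_weaken (T := DType)); assumption.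
  + apply dconv_ren, dconv_sym; assumption.
- apply dtyp_var; [constructor|]; assumption.
Qed.

(** * Generation, correctness and uniqueness of types *)

(** Inversion by case on the term: all final uses of the conversion rule are gathered into one
    [dconv] to [T]. *)
Definition generation G M T : Prop :=
  match M with
  | DVar x => exists A, nth_error G x = Some A /\ dconv (dren (Nat.add (S x)) A) T
  | DType => dconv DKind T
  | DKind => False
  | DApp M N =>
      exists A B, dtyp G M (DPi A B) /\ dtyp G N A /\ dconv (dsubst 0 N B) T
  | DLam A M =>
      exists B s, dsort s /\ dtyp G A DType /\ dtyp (A :: G) B s /\
                  dtyp (A :: G) M B /\ dconv (DPi A B) T
  | DPi A B =>
      exists s, dsort s /\ dtyp G A DType /\ dtyp (A :: G) B s /\ dconv s T
  | CU _ => dconv DType T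
  | CEl s A => dtyp G A (CU s) /\ dconv DType T
  | Cu s => exists s', ax s s' /\ dconv (CU s') T
  | CProd s1 s2 A B =>
      exists s3, rl s1 s2 s3 /\ dtyp G A (CU s1) /\
        dtyp G B (darrow (CEl s1 A) (CU s2)) /\ dconv (CU s3) T
  | Cabs s1 s2 A B M =>
      exists s3, rl s1 s2 s3 /\ dtyp G A (CU s1) /\
        dtyp G B (darrow (CEl s1 A) (CU s2)) /\
        dtyp G M (DPi (CEl s1 A) (CEl s2 (DApp (dren S B) (DVar 0)))) /\
        dconv (CEl s3 (CProd s1 s2 A B)) T
  | Capp s1 s2 A B M N =>
      exists s3, rl s1 s2 s3 /\ dtyp G A (CU s1) /\
        dtyp G B (darrow (CEl s1 A) (CU s2)) /\
        dtyp G M (CEl s3 (CProd s1 s2 A B)) /\ dtyp G N (CEl s1 A) /\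
        dconv (CEl s2 (DApp B N)) T
  end.

Lemma dtyp_generation G M T : dtyp G M T -> generation G M T.
Proof.
induction 1; simpl; eauto 10 using dconv_refl.
clear H H0 H1 IHdtyp2; destruct M; simpl in *;
  repeat match goal with
  | H : exists _, _ |- _ => destruct H
  | H : _ /\ _ |- _ => destruct H
  end; eauto 12 using dconv_trans.
Qed.

Lemma dtyp_darrow G A s1 s2 :
  dtyp G A (CU s1) -> dtyp G (darrow (CEl s1 A) (CU s2)) DType.
Proof.
intros h; assert (dtyp G (CEl s1 A) DType) by (apply dtyp_El; assumption).
apply dtyp_pi; [left; reflexivity | assumption|].
apply dtyp_U; constructor; assumption.
Qed.

Lemma dtyp_apply_var G A B s1 s2 :
  dtyp G A (CU s1) -> dtyp G B (darrow (CEl s1 A) (CU s2)) ->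
  dtyp (CEl s1 A :: G) (CEl s2 (DApp (dren S B) (DVar 0))) DType.
Proof.
intros hA hB; assert (hE : dtyp G (CEl s1 A) DType) by (apply dtyp_El; assumption).
apply dtyp_El, (dtyp_app (A := dren S (CEl s1 A)) (B := CU s2)).
- apply (dtyp_weaken hB hE).
- apply (dtyp_var (x := 0)); [constructor; assumption | reflexivity].
Qed.

Lemma dtyp_abs_body G A B s1 s2 :
  dtyp G A (CU s1) -> dtyp G B (darrow (CEl s1 A) (CU s2)) ->
  dtyp G (DPi (CEl s1 A) (CEl s2 (DApp (dren S B) (DVar 0)))) DType.
Proof.
intros hA hB; apply dtyp_pi; [left; reflexivity | apply dtyp_El; assumption|].
apply dtyp_apply_var; assumption.
Qed.

Lemma dtyp_apply G A B N s1 s2 :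
  dtyp G B (darrow (CEl s1 A) (CU s2)) -> dtyp G N (CEl s1 A) ->
  dtyp G (CEl s2 (DApp B N)) DType.
Proof. intros hB hN; apply dtyp_El, (dtyp_app hB hN). Qed.

Lemma dtyp_subst_sort G A B N s :
  dsort s -> dtyp (A :: G) B s -> dtyp G N A -> dtyp G (dsubst 0 N B) s.
Proof.
intros hs hB hN; rewrite <- (dsort_inst (scons N (@DVar P)) hs), <- dsubst0E.
eapply dtyp_subst; eassumption.
Qed.

(** Subject reduction uses this to know that the codomain of a product is typable, and so to convert
    the type of an application. *)
Lemma dtyp_type_correct G M T :
  dtyp G M T -> T = DKind \/ exists s, dsort s /\ dtyp G T s.
Proof.
assert (ht : @dsort P DType) by (left; reflexivity).
assert (hk : @dsort P DKind) by (right; reflexivity).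
induction 1.
- left; reflexivity.
- right; exists DType; split; [assumption | apply dtyp_lookup; assumption].
- right; eauto.
- destruct H as [-> | ->]; [right; exists DKind | left; reflexivity].
  split; [assumption | apply dtyp_type; eapply dtyp_wf; eassumption].
- right; exists s; split; [assumption | apply dtyp_pi; assumption].
- destruct IHdtyp1 as [h|[s [hs h]]]; [discriminate|].
  apply dtyp_generation in h; destruct h as [s' [hs' [_ [hB _]]]].
  right; exists s'; split; [assumption | eapply dtyp_subst_sort; eassumption].
- right; exists DKind; split; [assumption | apply dtyp_type; assumption].
- right; exists DKind; split; [assumption | apply dtyp_type; eapply dtyp_wf; eassumption].
- right; exists DType; split; [assumption | apply dtyp_U; assumption].
- right; exists DType; split; [assumption | apply dtyp_U; eapply dtyp_wf; eassumption].
- right; exists DType; split; [assumption|].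
  apply dtyp_El; eapply dtyp_Prod; eassumption.
- right; exists DType; split; [assumption | eapply dtyp_apply; eassumption].
Qed.

Lemma dtyp_pi_codomain G A B M :
  dtyp G M (DPi A B) -> exists s, dsort s /\ dtyp (A :: G) B s.
Proof.
intros h; destruct (dtyp_type_correct h) as [e|[s [_ hs]]]; [discriminate|].
apply dtyp_generation in hs; destruct hs as [s' [hs' [_ [hB _]]]]; eauto.
Qed.

(** Functionality determines the sorts in the types of [Cu], [CProd] and [Cabs]; the application
    case rests on injectivity of products. *)
Lemma dtyp_unique (hP : functional P) G M T :
  dtyp G M T -> forall T', dtyp G M T' -> dconv T T'.
Proof.
destruct hP as [hax hrl].
induction 1; intros T' h';
  assert (g := dtyp_generation h'); simpl in g;
  repeat match goal with
  | H : exists _, _ |- _ => destruct H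
  | H : _ /\ _ |- _ => destruct H
  end; auto.
- replace A with x0 by congruence; assumption.
- eapply dconv_trans; [apply dconv_sym; eassumption | auto].
- eapply dconv_trans; [|eassumption]; auto.
- eapply dconv_trans; [|eassumption]; apply dconv_pi; auto using dconv_refl.
- eapply dconv_trans; [|eassumption]; apply dconv_subst; [|apply dconv_refl].
  match goal with H : dtyp G M _ |- _ => apply IHdtyp1, dconv_pi_inj in H end; apply H1.
- replace s2 with x by eauto; assumption.
- replace s3 with x by eauto; assumption.
- replace s3 with x by eauto; assumption.
Qed.

(** * Subject reduction *)

Ltac inv_dred h := inversion h as [? ? [hb|hb]| | | | | | | | | | | | | | | |]; subst;
  try (inversion hb; subst).
Ltac back := first [apply dconv_refl | apply dconv_sym, rst_step; assumption
                   | apply rst_step; assumption].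

(** A reduced argument that occurs in the type of another argument, or of the whole term, changes
    that type by a conversion, which the conversion rule absorbs. *)
Lemma subject_reduction_step (hP : functional P) G M T : dtyp G M T -> forall M', dred M M' -> dtyp G M' T.
Proof.
assert (ht : @dsort P DType) by (left; reflexivity).
(* Reducing [A] changes the domain of the family [B], which has to be retyped. *)
assert (harr : forall G A A' B s1 s2, dred A A' -> dtyp G A' (CU s1) ->
          dtyp G B (darrow (CEl s1 A) (CU s2)) -> dtyp G B (darrow (CEl s1 A') (CU s2))).
{ intros G0 A A' B s1 s2 h hA hB.
  apply dtyp_conv with (1 := hB) (s := DType); auto using dtyp_darrow.
  apply dconv_pi; [apply dconv_El; back | apply dconv_refl]. }
induction 1; intros M' h.
- inv_dred h.
- inv_dred h.
- eapply dtyp_conv; eauto.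
- inv_dred h.
  + apply dtyp_pi; auto.
    eapply dtyp_ctx_conv; [eassumption | auto | back].
  + apply dtyp_pi; auto.
- inv_dred h.
  + assert (hc : dconv A A') by back.
    apply dtyp_conv with (DPi A' B) s; [|assumption|apply dtyp_pi; assumption|].
    * apply dtyp_lam with s; auto; (eapply dtyp_ctx_conv; [eassumption | auto | assumption]).
    * apply dconv_pi; [apply dconv_sym; assumption | apply dconv_refl].
  + eapply dtyp_lam; eauto.
- destruct (dtyp_pi_codomain H) as [s [hs hB]].
  assert (hBN : dtyp G (dsubst 0 N B) s) by (eapply dtyp_subst_sort; eassumption).
  inv_dred h.
  (* Beta at the root: injectivity of products relates the annotation of the abstraction to the
     domain at which it is applied. *)
  + apply dtyp_generation in H; destruct H as [B1 [s1 [hs1 [hA [hB1 [hM hc]]]]]].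
    apply dconv_pi_inj in hc; destruct hc as [hcA hcB].
    apply dtyp_conv with (dsubst 0 N B1) s; auto.
    * eapply dtyp_subst; [eassumption|].
      eapply dtyp_conv with (s := DType); eauto using dconv_sym.
    * apply dconv_subst; [assumption | apply dconv_refl].
  + eapply dtyp_app; eauto.
  + apply dtyp_conv with (dsubst 0 N' B) s; auto.
    * eapply dtyp_app; eauto.
    * apply dconv_subst; back.
- inv_dred h.
- inv_dred h.
  + apply dtyp_U; eapply dtyp_wf; eassumption.
  + apply dtyp_El; auto.
- inv_dred h.
- inv_dred h; eapply dtyp_Prod; eauto.
- inv_dred h.
  + apply dtyp_conv with (CEl s3 (CProd s1 s2 A' B)) DType; auto.
    * eapply dtyp_abs; eauto.
      eapply dtyp_conv with (s := DType); eauto using dtyp_abs_body.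
      apply dconv_pi; [apply dconv_El; back | apply dconv_refl].
    * apply dtyp_El; eapply dtyp_Prod; eassumption.
    * apply dconv_El, dconv_Prod; back.
  + apply dtyp_conv with (CEl s3 (CProd s1 s2 A B')) DType; auto.
    * eapply dtyp_abs; eauto.
      eapply dtyp_conv with (s := DType); eauto using dtyp_abs_body.
      apply dconv_pi; [apply dconv_refl|].
      apply dconv_El, dconv_app; [apply dconv_ren; back | apply dconv_refl].
    * apply dtyp_El; eapply dtyp_Prod; eassumption.
    * apply dconv_El, dconv_Prod; back.
  + eapply dtyp_abs; eauto.
- assert (hT : dtyp G (CEl s2 (DApp B N)) DType) by (eapply dtyp_apply; eassumption).
  inv_dred h.
  (* The [Capp] rule at the root: the parameters stored in [Cabs] may differ from those of [Capp],
     but injectivity of [CEl] and [CProd] makes them convertible. *)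
  + apply dtyp_generation in H2; destruct H2 as [s4 [r4 [hA [hB [hM hc]]]]].
    apply (dconv_El_inj hP) in hc; destruct hc as [_ hc]; apply dconv_Prod_inj in hc.
    apply dtyp_conv with (dsubst 0 N (CEl s2 (DApp (dren S B') (DVar 0)))) DType; auto.
    * eapply dtyp_app; [eassumption|].
      apply dtyp_conv with (CEl s1 A) DType; auto; [apply dtyp_El; assumption|].
      apply dconv_El, dconv_sym, hc.
    * change (dconv (CEl s2 (DApp (dsubst 0 N (dren S B')) N)) (CEl s2 (DApp B N))).
      rewrite dsubst0_dren; apply dconv_El, dconv_app; [apply hc | apply dconv_refl].
  + assert (hA' : dtyp G A' (CU s1)) by auto.
    assert (hB' : dtyp G B (darrow (CEl s1 A') (CU s2))) by eauto.
    eapply dtyp_capp; eauto.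
    * eapply dtyp_conv with (s := DType); [eassumption | assumption | |].
      -- apply dtyp_El; eapply dtyp_Prod; eassumption.
      -- apply dconv_El, dconv_Prod; back.
    * eapply dtyp_conv with (s := DType); [eassumption | assumption | |].
      -- apply dtyp_El; assumption.
      -- apply dconv_El; back.
  + apply dtyp_conv with (CEl s2 (DApp B' N)) DType; auto.
    * eapply dtyp_capp; eauto.
      eapply dtyp_conv with (s := DType); [eassumption | assumption | |].
      -- apply dtyp_El; eapply dtyp_Prod; eauto.
      -- apply dconv_El, dconv_Prod; back.
    * apply dconv_El, dconv_app; back.
  + eapply dtyp_capp; eauto.
  + apply dtyp_conv with (CEl s2 (DApp B N')) DType; auto.
    * eapply dtyp_capp; eauto.
    * apply dconv_El, dconv_app; back.
Qed.

Lemma subject_reduction (hP : functional P) G M M' T : dtyp G M T -> dreds M M' -> dtyp G M' T.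
Proof. intros h hr; revert h; induction hr; eauto using subject_reduction_step. Qed.

(** A common reduct keeps both types by subject reduction, and types are unique. This keeps the sort
    in [CEl s] fixed across the EPTS conversion rule. *)
Lemma dconv_unique_U (hP : functional P) G M M' s s' :
  dtyp G M (CU s) -> dtyp G M' (CU s') -> dconv M M' -> s = s'.
Proof.
intros h h' hc; destruct (church_rosser hc) as [N [r r']].
apply dconv_U_inj, (dtyp_unique hP (M := N) (G := G)); eapply subject_reduction; eassumption.
Qed.

End Typing.

(** * The translation preserves typing *)

Section Soundness.

Variable P : pts.
Hypothesis hP : functional P.
Implicit Types (M N A B e : eterm P) (G : list (eterm P)) (T : dterm P) (D : list (dterm P)).

(** The sorts are arbitrary here; it is [dwf D] that ties each of them to the typing of the
    translated declaration. *)
Definition translates_ctx G D : Prop :=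
  Forall2 (fun A T => exists s, T = CEl s (trans A)) G D.

(* For a sort [s] that is not a top sort, both [CU s] and [CEl s' (Cu s)] are
   accepted: which one is obtained depends on the typing derivation. *)
Definition translates_type D A T : Prop :=
  (exists s, T = CEl s (trans A) /\ dtyp D (trans A) (CU s)) \/
  (exists s, A = ESort s /\ T = CU s).

(** Brings the type found by induction into [CEl] form at a prescribed sort: uniqueness of sorts
    settles one form, and the rule on the code of a sort the other. *)
Lemma translates_type_El D A T (M : dterm P) s :
  translates_type D A T -> dtyp D M T -> dtyp D (trans A) (CU s) ->
  dtyp D M (CEl s (trans A)).
Proof.
intros [[s' [-> h]]|[s' [-> ->]]] hM hA.
- replace s with s'; [assumption|].
  apply (dconv_unique_U hP h hA), dconv_refl.
- destruct (dtyp_generation hA) as [s1 [h1 h2]]; apply dconv_U_inj in h2; subst s1.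
  apply dtyp_conv with (CU s') DType; auto.
  + left; reflexivity.
  + apply dtyp_El; assumption.
  + apply dconv_sym, dconv_El_u; assumption.
Qed.

Lemma translates_type_U D T (M : dterm P) s :
  translates_type D (ESort s) T -> dtyp D M T -> dtyp D M (CU s).
Proof.
intros [[s' [-> h]]|[s' [e ->]]] hM.
- destruct (dtyp_generation h) as [s1 [h1 h2]]; apply dconv_U_inj in h2; subst s1.
  apply dtyp_conv with (CEl s' (Cu s)) DType; auto.
  + left; reflexivity.
  + apply dtyp_U; eapply dtyp_wf; eassumption.
  + apply dconv_El_u; assumption.
- injection e as ->; assumption.
Qed.

Lemma dtyp_trans_binder D A B s1 s2 :
  dtyp D (trans A) (CU s1) -> dtyp (CEl s1 (trans A) :: D) (trans B) (CU s2) ->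
  dtyp D (DLam (CEl s1 (trans A)) (trans B)) (darrow (CEl s1 (trans A)) (CU s2)).
Proof.
intros hA hB; apply dtyp_lam with DType; [left; reflexivity | apply dtyp_El; assumption | | assumption].
apply dtyp_U; eapply dtyp_wf; eassumption.
Qed.

(** Induction on the EPTS derivation with [D] generalized: at a binder, the hypothesis on the domain
    makes the extended Dedukti context well-formed. *)
Lemma dtyp_trans_etyp G M A : etyp G M A ->
  forall D, translates_ctx G D -> dwf D ->
  exists T, translates_type D A T /\ dtyp D (trans M) T.
Proof.
assert (hcons : forall G D A s, translates_ctx G D -> dtyp D (trans A) (CU s) ->
  translates_ctx (A :: G) (CEl s (trans A) :: D) /\ dwf (CEl s (trans A) :: D)).
{ intros G' D A' s h1 h2; split; [constructor; eauto | constructor; apply dtyp_El; assumption]. }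
assert (ht : @dsort P DType) by (left; reflexivity).
induction 1 as [G x A _ hx|G s1 s2 _ hax|G M A B s hM IHM hB IHB hc
  |G s1 s2 s3 A B hrl hA IHA hB IHB|G s1 s2 s3 A B M hrl hA IHA hB IHB hM IHM
  |G s1 s2 s3 A B M N hrl hA IHA hB IHB hM IHM hN IHN]; intros D hD wf.
- assert (hx' : exists s, nth_error D x = Some (CEl s (trans A))).
  { clear wf; revert x hx; induction hD as [|A' T' G D [s ->]]; intros [|x] hx; try discriminate; simpl in *.
    - injection hx as ->; eauto.
    - auto. }
  destruct hx' as [s hs]; exists (dren (Nat.add (S x)) (CEl s (trans A))); split.
  + left; exists s; rewrite trans_ren; split; [reflexivity|].
    apply (dtyp_generation (dtyp_lookup wf hs)).
  + apply dtyp_var; assumption.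
- exists (CU s2); split; [right; eauto | apply dtyp_u; assumption].
- destruct (IHM D hD wf) as [T [hT hM']], (IHB D hD wf) as [U [hU hB']].
  apply (translates_type_U hU) in hB'.
  exists (CEl s (trans B)); split; [left; eauto|].
  assert (hc' := dconv_trans_econv hc).
  assert (hE : dtyp D (CEl s (trans B)) DType) by (apply dtyp_El; assumption).
  apply dtyp_conv with T DType; auto.
  destruct hT as [[s' [-> h]]|[s' [-> ->]]].
  + rewrite (dconv_unique_U hP h hB' hc'); apply dconv_El; assumption.
  (* Here [A] is a sort: [trans B] reduces to its code, and subject reduction supplies the axiom
     that makes the rule on [CEl] applicable. *)
  + destruct (church_rosser hc') as [Q [r1 r2]]; apply dreds_u in r1; subst Q.
    destruct (dtyp_generation (subject_reduction hP hB' r2)) as [s1 [h1 h2]].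
    apply dconv_U_inj in h2; subst s1.
    eapply dconv_trans; [apply dconv_sym, dconv_El_u; eassumption|].
    apply dconv_El; assumption.
- destruct (IHA D hD wf) as [T [hT hA']]; apply (translates_type_U hT) in hA'.
  destruct (hcons _ _ _ _ hD hA') as [hD' wf'].
  destruct (IHB _ hD' wf') as [U [hU hB']]; apply (translates_type_U hU) in hB'.
  exists (CU s3); split; [right; eauto|].
  eapply dtyp_Prod; eauto using dtyp_trans_binder.
- destruct (IHA D hD wf) as [T [hT hA']]; apply (translates_type_U hT) in hA'.
  destruct (hcons _ _ _ _ hD hA') as [hD' wf'].
  destruct (IHB _ hD' wf') as [U [hU hB']]; apply (translates_type_U hU) in hB'.
  destruct (IHM _ hD' wf') as [V [hV hM']].
  assert (hB2 := dtyp_trans_binder hA' hB').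
  exists (CEl s3 (trans (EPi s1 s2 A B))); split.
  { left; exists s3; split; [reflexivity | eapply dtyp_Prod; eassumption]. }
  eapply dtyp_abs; eauto.
  eapply dtyp_lam; eauto using dtyp_apply_var, dtyp_El.
  (* The body is expected in the family applied to the fresh variable, a redex that contracts to
     [trans B]. *)
  apply dtyp_conv with (CEl s2 (trans B)) DType; auto using dtyp_apply_var.
  + eapply translates_type_El; eassumption.
  + apply dconv_El, dconv_sym; simpl; eapply dconv_trans; [apply dconv_beta|].
    rewrite dsubst0_up_ren; apply dconv_refl.
- destruct (IHA D hD wf) as [T [hT hA']]; apply (translates_type_U hT) in hA'.
  destruct (hcons _ _ _ _ hD hA') as [hD' wf'].
  destruct (IHB _ hD' wf') as [U [hU hB']]; apply (translates_type_U hU) in hB'.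
  destruct (IHM _ hD wf) as [V [hV hM']], (IHN _ hD wf) as [W [hW hN']].
  apply (translates_type_El hW hN') in hA' as hN2.
  assert (hB2 := dtyp_trans_binder hA' hB').
  assert (hPi : dtyp D (trans (EPi s1 s2 A B)) (CU s3)) by (eapply dtyp_Prod; eassumption).
  apply (translates_type_El hV hM') in hPi.
  assert (hBN := dtyp_subst hB' hN2); rewrite trans_subst in hBN.
  exists (CEl s2 (trans (esubst 0 N B))); split; [left; eauto|].
  eapply dtyp_conv with (s := DType); [eapply dtyp_capp; eassumption | assumption | |].
  + apply dtyp_El; assumption.
  + rewrite <- trans_subst; apply dconv_El, dconv_beta.
Qed.

Lemma trans_ctx_translates G D : trans_ctx G D -> translates_ctx G D /\ dwf D.
Proof.
induction 1 as [|G D A s _ [hD wf] hA]; split; try constructor; eauto.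
destruct (dtyp_trans_etyp hA hD wf) as [T [hT hA']].
apply dtyp_El; eapply translates_type_U; eassumption.
Qed.

Lemma trans_sound G D M A T :
  trans_ctx G D -> trans_type G A T -> etyp G M A -> dtyp D (trans M) T.
Proof.
intros hD hT hM; destruct (trans_ctx_translates hD) as [hD' wf].
destruct (dtyp_trans_etyp hM hD' wf) as [U [hU hM']].
destruct hT as [s hs|A s hA].
- eapply translates_type_U; eassumption.
- destruct (dtyp_trans_etyp hA hD' wf) as [V [hV hA']].
  eapply translates_type_El; eauto using translates_type_U.
Qed.

End Soundness.

(** * Inverting beta-normal terms *)

Section Conservativity.

Variable P : pts.
Hypothesis hP : functional P.
Implicit Types (M N T : dterm P) (G : list (eterm P)) (D : list (dterm P)) (A e : eterm P).

Lemma etyp_wf G e A : etyp G e A -> ewf G.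
Proof. induction 1; assumption. Qed.

(** * Contexts and types up to conversion *)

(** Under a binder, the context receives the annotation found in the normal term, which is only
    convertible to the translated type. *)
Inductive conv_ctx : list (eterm P) -> list (dterm P) -> Prop :=
| conv_ctx_nil : conv_ctx [] []
| conv_ctx_cons G D A T s :
    conv_ctx G D -> etyp G A (ESort s) -> dconv T (CEl s (trans A)) ->
    conv_ctx (A :: G) (T :: D).

Lemma conv_ctx_lookup G D : conv_ctx G D -> forall x T, nth_error D x = Some T ->
  exists A s, nth_error G x = Some A /\
    dconv (dren (Nat.add (S x)) T) (CEl s (trans (eren (Nat.add (S x)) A))).
Proof.
intros h x T hx.
enough (h' : exists A s, nth_error G x = Some A /\ dconv T (CEl s (trans A))).
{ destruct h' as [A [s [hA hc]]]; exists A, s; split; [assumption|].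
  rewrite trans_ren; apply (dconv_ren (Nat.add (S x)) hc). }
revert x hx; induction h; intros [|x] hx; try discriminate; simpl in *; eauto.
injection hx as <-; eauto.
Qed.

Lemma conv_ctx_trans_ctx G D : trans_ctx G D -> conv_ctx G D.
Proof. induction 1; econstructor; eauto using dconv_refl. Qed.

Definition represents_type G A T : Prop :=
  (exists s, A = ESort s /\ dconv T (CU s)) \/
  (exists s, etyp G A (ESort s) /\ dconv T (CEl s (trans A))).

Lemma represents_type_head G A T : represents_type G A T ->
  exists T', dconv T T' /\ type_head T' = Some HU.
Proof. intros [[s [_ h]]|[s [_ h]]]; eexists; split; try eassumption; reflexivity. Qed.

Lemma represents_U G (s : sort P) : represents_type G (ESort s) (CU s).
Proof. left; eauto using dconv_refl. Qed.

Lemma represents_El G A M s :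
  etyp G A (ESort s) -> dconv (trans A) M -> represents_type G A (CEl s M).
Proof. intros hA hM; right; exists s; split; auto using dconv_El, dconv_sym. Qed.

(** If a [CEl] type is expected where a universe is found, the conversion forces the expected code
    to reduce to the code of the sort, which reflects to EPTS conversion. *)
Lemma etyp_represents_U G e A T s :
  etyp G e (ESort s) -> dconv (CU s) T -> represents_type G A T -> etyp G e A.
Proof.
intros he hT [[s' [-> h]]|[s' [hA h]]]; assert (hc := dconv_trans hT h).
- apply dconv_U_inj in hc; subst; assumption.
- apply dconv_sym, dconv_El_U in hc; destruct hc as [hax hr].
  eapply etyp_conv; [eassumption | eassumption|].
  apply econv_dconv_trans, dconv_sym, rt_rst; assumption.
Qed.

(** If a universe is expected instead, the axiom extracted from the conversion makes its sort
    typable, as the EPTS conversion rule demands. *)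
Lemma etyp_represents_El G e A A' T s :
  etyp G e A' -> dconv (CEl s (trans A')) T -> represents_type G A T -> etyp G e A.
Proof.
intros he hT [[s' [-> h]]|[s' [hA h]]]; assert (hc := dconv_trans hT h).
- apply dconv_El_U in hc; destruct hc as [hax hr].
  eapply etyp_conv with (s := s); [eassumption | apply etyp_sort|].
  + eapply etyp_wf; eassumption.
  + assumption.
  + apply econv_dconv_trans, rt_rst; assumption.
- apply (dconv_El_inj hP) in hc; destruct hc as [_ hc].
  eapply etyp_conv; [eassumption | eassumption|].
  apply econv_dconv_trans; assumption.
Qed.

(** * Invertibility of normal terms *)

(** Measure for the induction: the body of an argument lies below its abstraction, two levels down,
    out of reach of structural induction. *)
Fixpoint dsize M : nat :=
  match M with
  | DVar _ | DType | DKind | CU _ | Cu _ => 1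
  | DApp M N | DLam M N | DPi M N | CProd _ _ M N => S (dsize M + dsize N)
  | CEl _ M => S (dsize M)
  | Cabs _ _ A B M => S (dsize A + dsize B + dsize M)
  | Capp _ _ A B M N => S (dsize A + dsize B + dsize M + dsize N)
  end.

Lemma beta_normal_context (C : dterm P -> dterm P) M :
  (forall R M N, dclos R M N -> dclos R (C M) (C N)) ->
  beta_normal (C M) -> beta_normal M.
Proof. intros hC h N hN; apply (h (C N)), hC; assumption. Qed.

(** Neither a variable of such a context nor a fully applied constant has product type. The function
    part of an application would by induction be an abstraction, making a redex. *)
Lemma normal_pi_lam G D M (A B : dterm P) :
  conv_ctx G D -> beta_normal M -> dtyp D M (DPi A B) -> exists T N, M = DLam T N.
Proof.
intros hD; revert A B; induction M; intros A B hn h; apply dtyp_generation in h; simpl in h;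
  repeat match goal with
  | H : exists _, _ |- _ => destruct H
  | H : _ /\ _ |- _ => destruct H
  | H : dsort _ |- _ => destruct H; subst
  end; try no_conv; eauto; try contradiction.
- destruct (conv_ctx_lookup hD H) as [A' [s [_ hc]]].
  apply dconv_sym in hc; apply (dconv_trans hc) in H0; no_conv.
- edestruct IHM1 as [T [N ->]]; [|eassumption|].
  + apply (beta_normal_context (C := fun X => DApp X M2)) in hn; auto using dclos.
  + exfalso; eapply hn; constructor; constructor.
Qed.

Lemma normal_pi_inversion G D M (U V : dterm P) A s :
  conv_ctx G D -> beta_normal M -> dtyp D M (DPi U V) ->
  etyp G A (ESort s) -> dconv U (CEl s (trans A)) ->
  exists T N V', M = DLam T N /\ beta_normal N /\ dtyp (T :: D) N V' /\ dconv V' V /\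
    conv_ctx (A :: G) (T :: D) /\ dconv (CEl s (trans A)) T.
Proof.
intros hD hn hM hA hU; destruct (normal_pi_lam hD hn hM) as [T [N ->]].
destruct (dtyp_generation hM) as [V' [s' [_ [_ [_ [hN hc]]]]]].
apply dconv_pi_inj in hc; destruct hc as [hT hV].
assert (hc := dconv_trans hT hU).
exists T, N, V'; repeat split; auto using dconv_sym.
- apply (beta_normal_context (C := DLam T)) in hn; auto using dclos.
- econstructor; eassumption.
Qed.

(** The three conclusions are obtained together: the H-equivalences of earlier arguments give the
    conversions by which later ones are typed. *)
Lemma normal_conservative n : forall M, dsize M < n -> forall G D A T,
  conv_ctx G D -> ewf G -> beta_normal M -> dtyp D M T -> represents_type G A T ->
  exists e, invertible M e /\ etyp G e A /\ H_equiv (trans e) M.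
Proof.
induction n as [|n IH]; [lia|].
intros M hsize G D A T hD wf hn hM hT.
assert (c := congruence_rst (@H_root P)).
(* Arguments typed by a universe or by [CEl] are inverted directly. *)
assert (harg : forall (C : dterm P -> dterm P) N, M = C N ->
  (forall R M N, dclos R M N -> dclos R (C M) (C N)) -> dsize N < n ->
  forall B U, dtyp D N U -> represents_type G B U ->
  exists e, invertible N e /\ etyp G e B /\ H_equiv (trans e) N).
{ intros C N -> hC hs B U hN hB; eapply IH; eauto using beta_normal_context. }
(* Arguments of product type are abstractions, inverted through their body in the extended context.
   The bound [dsize N <= n] suffices, the body being strictly smaller. *)
assert (hfam : forall (C : dterm P -> dterm P) N, M = C N ->
  (forall R M N, dclos R M N -> dclos R (C M) (C N)) -> dsize N <= n ->
  forall a s U V B, dtyp D N (DPi U V) -> etyp G a (ESort s) -> dconv U (CEl s (trans a)) ->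
  represents_type (a :: G) B V ->
  exists T' N' e, N = DLam T' N' /\ invertible N' e /\ etyp (a :: G) e B /\
    H_equiv (DLam (CEl s (trans a)) (trans e)) N /\ dconv (trans e) N').
{ intros C N eN hC hs a s U V B hN ha hU hB.
  assert (hnN : beta_normal N) by (subst M; eauto using beta_normal_context).
  destruct (normal_pi_inversion hD hnN hN ha hU)
    as [T' [N' [V' [-> [hn' [hN' [hV' [hD' hc]]]]]]]].
  simpl in hs; destruct (IH N') with (G := a :: G) (D := T' :: D) (A := B) (T := V')
    as [e [h1 [h2 h3]]]; auto; [lia | econstructor; eassumption | |].
  - destruct hB as [[s0 [h1 h2]]|[s0 [h1 h2]]]; [left|right]; exists s0; split; auto;
      eapply dconv_trans; eassumption.
  - exists T', N', e; repeat split; auto using H_equiv_lam, H_equiv_dconv. }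
assert (hg := dtyp_generation hM).
destruct M; simpl in hg, hsize.
- destruct hg as [U [hx hc]]; destruct (conv_ctx_lookup hD hx) as [A' [s [hx' hc']]].
  exists (EVar x); split; [constructor | split; [|apply rst_refl]].
  eapply etyp_represents_El; [apply etyp_var; eassumption | | eassumption].
  eapply dconv_trans; [apply dconv_sym|]; eassumption.
- destruct (represents_type_head hT) as [T' [hc hh]].
  assert (hc' := dconv_type_head (dconv_trans hg hc) eq_refl hh); discriminate.
- contradiction.
(* The function part of an application would be an abstraction, contradicting normality. *)
- exfalso; destruct hg as [A' [B' [h _]]].
  destruct (normal_pi_lam hD (beta_normal_context (C := fun X => DApp X M2)
    (fun R M N h => dclos_app1 _ h) hn) h) as [T' [N ->]].
  eapply hn; constructor; constructor.
- destruct hg as [B [s [_ [_ [_ [_ hg]]]]]]; destruct (represents_type_head hT) as [T' [hc hh]].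
  assert (hc' := dconv_type_head (dconv_trans hg hc) eq_refl hh); discriminate.
- destruct hg as [s [hs [_ [_ hg]]]]; destruct (represents_type_head hT) as [T' [hc hh]].
  destruct hs; subst;
  assert (hc' := dconv_type_head (dconv_trans hg hc) eq_refl hh); discriminate.
- destruct (represents_type_head hT) as [T' [hc hh]].
  assert (hc' := dconv_type_head (dconv_trans hg hc) eq_refl hh); discriminate.
- destruct hg as [_ hg]; destruct (represents_type_head hT) as [T' [hc hh]].
  assert (hc' := dconv_type_head (dconv_trans hg hc) eq_refl hh); discriminate.
- destruct hg as [s' [hax hc]].
  exists (ESort s); split; [constructor | split; [|apply rst_refl]].
  eapply etyp_represents_U; [apply etyp_sort| |]; eassumption.
- destruct hg as [s3 [hrl [hA [hB hc]]]].
  destruct (harg (fun X => CProd s1 s2 X M2) M1) with (B := ESort (P := P) s1) (U := CU (P := P) s1)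
    as [a [ia [ta ea]]]; auto using dclos, represents_U; [lia|].
  destruct (hfam (CProd s1 s2 M1) M2) with (a := a) (s := s1) (B := ESort (P := P) s2)
    (U := CEl s1 M1) (V := CU (P := P) s2)
    as [T' [N' [b [-> [ib [tb [eb _]]]]]]]; auto using dclos, represents_U;
    [lia | auto using dconv_El, dconv_sym, H_equiv_dconv|].
  exists (EPi s1 s2 a b); split; [constructor; assumption | split].
  + eapply etyp_represents_U; [eapply etyp_prod| |]; eassumption.
  + apply (cg_Prod c); assumption.
- destruct hg as [s3 [hrl [hA [hB [hM3 hc]]]]].
  destruct (harg (fun X => Cabs s1 s2 X M2 M3) M1) with (B := ESort (P := P) s1) (U := CU (P := P) s1)
    as [a [ia [ta ea]]]; auto using dclos, represents_U; [lia|].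
  assert (hA' : dconv (CEl s1 M1) (CEl s1 (trans a))) by auto using dconv_El, dconv_sym, H_equiv_dconv.
  destruct (hfam (fun X => Cabs s1 s2 M1 X M3) M2) with (a := a) (s := s1) (B := ESort (P := P) s2)
    (U := CEl s1 M1) (V := CU (P := P) s2)
    as [T' [N' [b [-> [ib [tb [eb cb]]]]]]]; auto using dclos, represents_U; [lia|].
  (* The signature types the body by the family applied to the fresh variable, which contracts to a
     term convertible to [trans b]. *)
  assert (hB' : represents_type (a :: G) b (CEl s2 (DApp (dren S (DLam T' N')) (DVar 0)))).
  { apply represents_El; [assumption|].
    apply (dconv_trans cb), dconv_sym; simpl; rewrite <- (dsubst0_up_ren N') at 2.
    apply dconv_beta. }
  destruct (hfam (Cabs s1 s2 M1 (DLam T' N')) M3) with (5 := ta) (6 := hA') (7 := hB')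
    as [T'' [N'' [m [-> [im [tm [em _]]]]]]]; auto using dclos; [lia|].
  exists (ELam s1 s2 a b m); split; [constructor; assumption | split].
  + eapply etyp_represents_El; [eapply etyp_abs; eassumption| |eassumption].
    eapply dconv_trans; [|eassumption]; apply dconv_El, dconv_Prod; apply H_equiv_dconv; assumption.
  + apply (cg_abs c); assumption.
- destruct hg as [s3 [hrl [hA [hB [hM3 [hM4 hc]]]]]].
  destruct (harg (fun X => Capp s1 s2 X M2 M3 M4) M1) with (B := ESort (P := P) s1) (U := CU (P := P) s1)
    as [a [ia [ta ea]]]; auto using dclos, represents_U; [lia|].
  destruct (hfam (fun X => Capp s1 s2 M1 X M3 M4) M2) with (a := a) (s := s1) (B := ESort (P := P) s2)
    (U := CEl s1 M1) (V := CU (P := P) s2)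
    as [T' [N' [b [-> [ib [tb [eb cb]]]]]]]; auto using dclos, represents_U;
    [lia | auto using dconv_El, dconv_sym, H_equiv_dconv|].
  destruct (harg (fun X => Capp s1 s2 M1 (DLam T' N') X M4) M3)
    with (B := EPi s1 s2 a b) (U := CEl s3 (CProd s1 s2 M1 (DLam T' N')))
    as [m [im [tm em]]]; auto using dclos; [lia | |].
  { apply represents_El; [eapply etyp_prod; eassumption|].
    apply dconv_Prod; apply H_equiv_dconv; assumption. }
  destruct (harg (Capp s1 s2 M1 (DLam T' N') M3) M4) with (B := a) (U := CEl s1 M1)
    as [k [ik [tk ek]]]; auto using dclos, represents_El, H_equiv_dconv; [lia|].
  exists (EApp s1 s2 a b m k); split; [constructor; assumption | split].
  + eapply etyp_represents_El; [eapply etyp_app; eassumption| |eassumption].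
    eapply dconv_trans; [|eassumption]; apply dconv_El.
    rewrite <- trans_subst; apply dconv_sym.
    eapply dconv_trans; [apply dconv_beta|].
    apply dconv_subst; auto using dconv_sym, H_equiv_dconv.
  + apply (cg_capp c); assumption.
Qed.

End Conservativity.

(** * Beta-normalization *)

Section Levels.

Variable P : pts.
Implicit Types (M N A B T : dterm P) (D : list (dterm P)).

(* Levels are syntactic because conversion may pass through untypable terms. *)
Inductive level : Type := Obj | Fam | Kd.

(** Variables are objects, because the declarations of a context have type [DType]. *)
Inductive lev : level -> dterm P -> Prop :=
| lev_var x : lev Obj (DVar x)
| lev_type : lev Kd DType
| lev_app l M N : l <> Kd -> lev l M -> lev Obj N -> lev l (DApp M N)
| lev_lam l A M : l <> Kd -> lev Fam A -> lev l M -> lev l (DLam A M)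
| lev_pi l A B : l <> Obj -> lev Fam A -> lev l B -> lev l (DPi A B)
| lev_U s : lev Fam (CU s)
| lev_El s A : lev Obj A -> lev Fam (CEl s A)
| lev_u s : lev Obj (Cu s)
| lev_Prod s1 s2 A B : lev Obj A -> lev Obj B -> lev Obj (CProd s1 s2 A B)
| lev_abs s1 s2 A B M :
    lev Obj A -> lev Obj B -> lev Obj M -> lev Obj (Cabs s1 s2 A B M)
| lev_capp s1 s2 A B M N :
    lev Obj A -> lev Obj B -> lev Obj M -> lev Obj N -> lev Obj (Capp s1 s2 A B M N).

Lemma lev_unique l M : lev l M -> forall l', lev l' M -> l = l'.
Proof. induction 1; intros l' h'; inversion h'; subst; auto. Qed.

Lemma lev_ren l M : lev l M -> forall r, lev l (dren r M).
Proof. induction 1; simpl; intros; constructor; auto. Qed.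

Lemma lev_inst l M : lev l M -> forall f, (forall x, lev Obj (f x)) -> lev l (dinst f M).
Proof.
assert (hup : forall f, (forall x, lev Obj (f x)) -> forall x, lev Obj (dup f x)).
{ intros f h [|x]; simpl; [constructor | apply lev_ren; auto]. }
induction 1; simpl; intros; auto; constructor; auto.
Qed.

Lemma lev_subst l M N : lev l M -> lev Obj N -> lev l (dsubst 0 N M).
Proof.
intros hM hN; rewrite dsubst0E; apply lev_inst; [assumption|].
intros [|x]; simpl; [assumption | constructor].
Qed.

(** * Erasure into simple types *)

Inductive sty : Type := base | arr (a b : sty).

(* Dependency is forgotten; [CU] and [CEl] have the same erasure, so that the
   erasure of types is invariant under conversion. *)
Fixpoint erase T : sty :=
  match T with
  | DPi A B => arr (erase A) (erase B)
  | DLam _ M => erase M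
  | DApp M _ => erase M
  | _ => base
  end.

Lemma erase_ren M : forall r, erase (dren r M) = erase M.
Proof. induction M; simpl; intros; auto; f_equal; auto. Qed.

(** Above the level of objects, variables occur only in positions that erasure forgets. *)
Lemma erase_inst l M : lev l M -> l <> Obj -> forall f, erase (dinst f M) = erase M.
Proof. induction 1; simpl; intros; try congruence; auto; f_equal; auto; apply IHlev1; discriminate. Qed.

Lemma lev_dred l M : lev l M -> forall M', dred M M' ->
  lev l M' /\ (l <> Obj -> erase M' = erase M).
Proof.
induction 1; intros Q hQ; inversion hQ as [? ? [hb|hb]| | | | | | | | | | | | | | | |]; subst;
  try (inversion hb; subst);
  repeat match goal with
  | IH : forall M', dred ?M M' -> _, H : dclos _ ?M _ |- _ =>
      destruct (IH _ H) as [? ?]; clear IH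
  end; try (split; [constructor; assumption | simpl; intros; auto; congruence]).
- inversion H0; subst; split; [apply lev_subst; assumption|].
  intros hl; simpl; rewrite dsubst0E; eapply erase_inst; eassumption.
- split; [constructor; assumption|].
  intros hl; simpl; f_equal; auto; apply H4; discriminate.
- split; [constructor; assumption|].
  intros hl; simpl; f_equal; auto.
- inversion H1; subst; split; [constructor; auto; discriminate | congruence].
Qed.

Lemma lev_dreds M N : dreds M N -> forall l, lev l M ->
  lev l N /\ (l <> Obj -> erase N = erase M).
Proof.
induction 1 as [M N h| |M N T _ IH1 _ IH2]; intros l hl; auto.
- eapply lev_dred; eassumption.
- destruct (IH1 _ hl) as [h1 h2], (IH2 _ h1) as [h3 h4].
  split; [assumption | intros; rewrite h4, h2; auto].
Qed.

(** Confluence replaces the conversion, whose intermediate terms may lack a level, by two reductions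
    that preserve the level and, above objects, the erasure. *)
Lemma lev_dconv M N l l' : dconv M N -> lev l M -> lev l' N ->
  l = l' /\ (l <> Obj -> erase M = erase N).
Proof.
intros hc h h'; destruct (church_rosser hc) as [Q [r r']].
destruct (lev_dreds r h) as [h1 h2], (lev_dreds r' h') as [h3 h4].
assert (l = l') by (eapply lev_unique; eassumption); subst l'.
split; [reflexivity | intros hl; rewrite <- h2, <- h4; auto].
Qed.

Lemma dconv_kind_lev M l : dconv DKind M -> lev l M -> False.
Proof.
intros hc h; destruct (church_rosser hc) as [Q [r r']].
apply dreds_kind in r; subst Q; destruct (lev_dreds r' h) as [h' _]; inversion h'.
Qed.

Definition lev_above (l : level) T : Prop :=
  match l with Obj => lev Fam T | Fam => lev Kd T | Kd => T = DKind end.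

Lemma lev_above_sort l T : dsort T -> lev_above l T -> l <> Obj.
Proof. intros [-> | ->] h e; subst l; inversion h. Qed.

Lemma lev_above_pi l A B : l <> Kd -> lev_above l (DPi A B) ->
  lev Fam A /\ lev_above l B /\ exists l', l' <> Obj /\ lev l' B.
Proof. intros hl h; destruct l; simpl in *; [| |congruence]; inversion h; subst; eauto. Qed.

(** Conversion cannot move a type to another level, and [DKind] is convertible to no term that has
    one, so a term stays one level below its type. *)
Lemma dtyp_lev D M T : dtyp D M T -> Forall (lev Fam) D -> exists l, lev l M /\ lev_above l T.
Proof.
assert (type_fam : forall M, (exists l, lev l M /\ lev_above l DType) -> lev Fam M).
{ intros N [[| |] [h h']]; simpl in h'; [inversion h' | assumption | discriminate]. }
assert (obj : forall M T, (exists l, lev l M /\ lev_above l T) -> lev Fam T -> lev Obj M).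
{ intros N T' [l' [h3 h4]] hA; destruct l'; simpl in h4; [assumption | |subst; inversion hA].
  assert (e := lev_unique hA h4); discriminate. }
assert (arrow_fam : forall A s1 s2, lev Obj A -> lev Fam (darrow (CEl s1 A) (CU s2))).
{ intros A s1 s2 hA; repeat constructor; [discriminate | assumption]. }
induction 1; intros hD.
- exists Kd; split; [constructor | reflexivity].
- exists Obj; split; [constructor|]; simpl; apply lev_ren.
  rewrite Forall_forall in hD; eapply hD, nth_error_In; eassumption.
- destruct (IHdtyp1 hD) as [l [h1 h2]], (IHdtyp2 hD) as [l' [h3 h4]].
  exists l; split; [assumption|].
  destruct l; simpl in *; [| |exfalso; subst; eapply dconv_kind_lev; eassumption];
    destruct (lev_dconv H2 h2 h3) as [<- _]; assumption.
- destruct (IHdtyp2) as [l [h1 h2]]; [constructor; auto|].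
  exists l; split; [|assumption].
  constructor; auto; eapply lev_above_sort; eassumption.
- assert (hA : lev Fam A) by auto.
  destruct (IHdtyp3) as [l [h1 h2]]; [constructor; auto|].
  destruct (IHdtyp2) as [l' [h3 h4]]; [constructor; auto|].
  assert (l' <> Obj) by (eapply lev_above_sort; eassumption).
  assert (l <> Kd) by (intros ->; simpl in h2; subst; inversion h3).
  exists l; split; [constructor; assumption|].
  destruct l; simpl in *; [| |congruence]; (constructor; [discriminate | assumption..]).
- destruct (IHdtyp1 hD) as [l [h1 h2]], (IHdtyp2 hD) as [l' [h3 h4]].
  assert (hl : l <> Kd) by (intros ->; simpl in h2; discriminate).
  destruct (lev_above_pi hl h2) as [hA [hB _]].
  assert (hN : lev Obj N) by eauto.
  exists l; split; [constructor; assumption|].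
  destruct l; simpl in *; [apply lev_subst.. |congruence]; assumption.
- exists Fam; split; constructor.
- exists Fam; split; constructor; eapply obj; [auto | constructor].
- exists Obj; split; constructor.
- assert (hA : lev Obj A) by (eapply obj; [auto | constructor]).
  exists Obj; split; constructor; [assumption | eapply obj; auto].
- assert (hA : lev Obj A) by (eapply obj; [auto | constructor]).
  assert (hB : lev Obj B) by (eapply obj; auto).
  exists Obj; split; [constructor; auto | repeat constructor; assumption].
  eapply obj; [auto|]; repeat constructor; auto using lev_ren; discriminate.
- assert (hA : lev Obj A) by (eapply obj; [auto | constructor]).
  assert (hB : lev Obj B) by (eapply obj; auto).
  assert (hN : lev Obj N) by (eapply obj; [auto | constructor; assumption]).
  exists Obj; split; [constructor; auto | repeat constructor; auto; discriminate].
  eapply obj; [auto | repeat constructor; assumption].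
Qed.

(** * Simple typing of Dedukti terms *)

(** Families and annotations are typed as well, since beta also acts there. Constants are opaque
    symbols with result [base]. *)
Inductive styp : (nat -> sty) -> dterm P -> sty -> Prop :=
| styp_var (G : nat -> sty) x a : G x = a -> styp G (DVar x) a
| styp_type G : styp G DType base
| styp_app G M N a b : styp G M (arr a b) -> styp G N a -> styp G (DApp M N) b
| styp_lam G A M a b :
    styp G A base -> styp (scons a G) M b -> styp G (DLam A M) (arr a b)
| styp_pi G A B a :
    styp G A base -> styp (scons a G) B base -> styp G (DPi A B) base
| styp_U G s : styp G (CU s) base
| styp_El G s A : styp G A base -> styp G (CEl s A) base
| styp_u G s : styp G (Cu s) base
| styp_Prod G s1 s2 A B :
    styp G A base -> styp G B (arr base base) -> styp G (CProd s1 s2 A B) base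
| styp_abs G s1 s2 A B M :
    styp G A base -> styp G B (arr base base) -> styp G M (arr base base) ->
    styp G (Cabs s1 s2 A B M) base
| styp_capp G s1 s2 A B M N :
    styp G A base -> styp G B (arr base base) -> styp G M base -> styp G N base ->
    styp G (Capp s1 s2 A B M N) base.

(** In the conversion case both types have a level, so their erasures agree; in the application case
    substitution does not affect the erasure of the codomain. *)
Lemma dtyp_styp D M T : dtyp D M T -> Forall (lev Fam) D ->
  forall G, (forall x A, nth_error D x = Some A -> G x = erase A) -> styp G M (erase T).
Proof.
assert (hcons : forall D A (G : nat -> sty), dtyp D A DType -> Forall (lev Fam) D ->
  (forall x A, nth_error D x = Some A -> G x = erase A) ->
  Forall (lev Fam) (A :: D) /\
  (forall x B, nth_error (A :: D) x = Some B -> scons (erase A) G x = erase B)).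
{ intros D' A G hA hD hG; split.
  - constructor; [|assumption].
    destruct (dtyp_lev hA hD) as [[| |] [h h']]; simpl in h';
      [inversion h' | assumption | discriminate].
  - intros [|x] B hx; simpl in *; [congruence | auto]. }
assert (hs : forall s : dterm P, dsort s -> erase s = base) by (intros s [-> | ->]; reflexivity).
induction 1; intros hD G' hG; simpl in *.
- constructor.
- rewrite erase_ren; constructor; auto.
- destruct (dtyp_lev H hD) as [l [h1 h2]], (dtyp_lev H1 hD) as [l' [h3 h4]].
  replace (erase B) with (erase A); [auto|].
  destruct l; simpl in h2; [| |exfalso; subst; eapply dconv_kind_lev; eassumption];
    apply (lev_dconv H2 h2 h3); discriminate.
- rewrite (hs _ H) in *; destruct (hcons _ _ _ H0 hD hG); econstructor; eauto.
- destruct (hcons _ _ _ H0 hD hG); constructor; auto.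
- destruct (dtyp_lev H hD) as [l [h1 h2]].
  assert (hl : l <> Kd) by (intros ->; simpl in h2; discriminate).
  destruct (lev_above_pi hl h2) as [_ [_ [l' [hl' hB]]]].
  rewrite dsubst0E, (erase_inst hB hl'); econstructor; eauto.
- constructor.
- constructor; auto.
- constructor.
- constructor; auto.
- constructor; auto.
- constructor; auto.
Qed.

Lemma styp_ren G M a : styp G M a ->
  forall G' r, (forall x, G' (r x) = G x) -> styp G' (dren r M) a.
Proof.
assert (hup : forall G G' (a : sty) r, (forall x, G' (r x) = G x) ->
  forall x, scons a G' (up_ren r x) = scons a G x) by (intros G0 G' a0 r h [|x]; simpl; auto).
induction 1; simpl; intros; try (econstructor; eauto; fail).
constructor; congruence.
Qed.

(** * Normal forms by hereditary substitution *)

Definition is_lam M : bool := match M with DLam _ _ => true | _ => false end.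

Fixpoint nf M : Prop :=
  match M with
  | DVar _ | DType | DKind | CU _ | Cu _ => True
  | DApp M N => is_lam M = false /\ nf M /\ nf N
  | DLam M N | DPi M N | CProd _ _ M N => nf M /\ nf N
  | CEl _ M => nf M
  | Cabs _ _ A B M => nf A /\ nf B /\ nf M
  | Capp _ _ A B M N => nf A /\ nf B /\ nf M /\ nf N
  end.

Lemma nf_beta_normal M : nf M -> beta_normal M.
Proof.
intros h N hN; revert h; induction hN as [M N []| | | | | | | | | | | | | | | |]; simpl;
  intuition discriminate.
Qed.

Lemma is_lam_ren M r : is_lam (dren r M) = is_lam M.
Proof. destruct M; reflexivity. Qed.

Lemma nf_ren M : forall r, nf M -> nf (dren r M).
Proof. induction M; simpl; intros; rewrite ?is_lam_ren; intuition auto. Qed.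

Fixpoint tsize (a : sty) : nat :=
  match a with base => 0 | arr a b => S (tsize a + tsize b) end.

Ltac hered IH hn h1 h2 h3 M' r n t l :=
  destruct (IH hn _ _ h1 h2 h3) as [M' [r [n [t l]]]].

(* Hereditary substitution: a redex created by substituting at types of size at
   most [n] has a domain of size less than [n]. *)
Lemma nf_inst n : forall G M b, styp G M b -> nf M ->
  forall G' f, (forall x, styp G' (f x) (G x)) -> (forall x, nf (f x)) ->
  (forall x, is_lam (f x) = true -> tsize (G x) <= n) ->
  exists M', dbetas (dinst f M) M' /\ nf M' /\ styp G' M' b /\
    (is_lam M' = true -> is_lam M = true \/ tsize b <= n).
Proof.
assert (c := congruence_rt (@beta_root P)).
induction n as [n IHn] using lt_wf_ind.
assert (hup : forall G G' f (a : sty), 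
  (forall x, styp G' (f x) (G x)) -> (forall x, nf (f x)) ->
  (forall x, is_lam (f x) = true -> tsize (G x) <= n) ->
  (forall x, styp (scons a G') (dup f x) (scons a G x)) /\ (forall x, nf (dup f x)) /\
  (forall x, is_lam (dup f x) = true -> tsize (scons a G x) <= n)).
{ intros G G' f a h1 h2 h3; repeat split; intros [|x]; simpl; rewrite ?is_lam_ren;
    auto using nf_ren; try discriminate.
  - constructor; reflexivity.
  - eapply styp_ren; [apply h1 | reflexivity]. }
induction 1 as [G x b hx|G|G M N a b _ IHM _ IHN|G A M a b _ IHA _ IHM|G A B a _ IHA _ IHB
  |G s|G s A _ IHA|G s|G s1 s2 A B _ IHA _ IHB|G s1 s2 A B M _ IHA _ IHB _ IHM
  |G s1 s2 A B M N _ IHA _ IHB _ IHM _ IHN]; simpl; intros hn G' f h1 h2 h3.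
- exists (f x); subst b; repeat split; auto; apply rt_refl.
- exists DType; repeat split; auto; [apply rt_refl | constructor].
- destruct hn as [hl [hM hN]].
  hered IHM hM h1 h2 h3 M' rM nM tM lM.
  hered IHN hN h1 h2 h3 N' rN nN tN lN.
  destruct (is_lam M') eqn:e.
  + destruct M' as [| | | |A M'| | | | | | |]; try discriminate.
    inversion tM; subst; destruct nM as [_ nM].
    (* The function part was not an abstraction, so the substitution made it one and its type
       [arr a b] has size at most [n]: the induction on [n] applies at [a], and [b] respects the
       bound claimed for the result. *)
    destruct lM as [lM|lM]; [reflexivity | congruence|]; simpl in lM.
    assert (hlt : tsize a < n) by lia.
    match goal with H : styp (scons a G') M' b |- _ =>
      destruct (IHn _ hlt _ _ _ H nM G' (scons N' (@DVar P))) as [Q [rQ [nQ [tQ _]]]] end.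
    * intros [|x]; simpl; [assumption | constructor; reflexivity].
    * intros [|x]; simpl; auto.
    * intros [|x]; simpl; [auto | discriminate].
    * exists Q; repeat split; auto; [|right; lia].
      eapply rt_trans; [apply (cg_app c); eassumption|].
      eapply rt_trans; [apply rt_step; constructor; constructor|].
      rewrite dsubst0E; assumption.
  + exists (DApp M' N'); repeat split; auto.
    * apply (cg_app c); assumption.
    * econstructor; eassumption.
- destruct hn as [hA hM], (hup _ _ _ a h1 h2 h3) as [k1 [k2 k3]].
  hered IHA hA h1 h2 h3 A' rA nA tA lA.
  hered IHM hM k1 k2 k3 M' rM nM tM lM.
  exists (DLam A' M'); repeat split; auto; [apply (cg_lam c) | constructor]; assumption.
- destruct hn as [hA hB], (hup _ _ _ a h1 h2 h3) as [k1 [k2 k3]].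
  hered IHA hA h1 h2 h3 A' rA nA tA lA.
  hered IHB hB k1 k2 k3 B' rB nB tB lB.
  exists (DPi A' B'); repeat split; auto; [apply (cg_pi c) | econstructor]; eassumption.
- exists (CU s); repeat split; auto; [apply rt_refl | constructor].
- hered IHA hn h1 h2 h3 A' rA nA tA lA.
  exists (CEl s A'); repeat split; auto; [apply (cg_El c) | constructor]; assumption.
- exists (Cu s); repeat split; auto; [apply rt_refl | constructor].
- destruct hn as [hA hB].
  hered IHA hA h1 h2 h3 A' rA nA tA lA.
  hered IHB hB h1 h2 h3 B' rB nB tB lB.
  exists (CProd s1 s2 A' B'); repeat split; auto; [apply (cg_Prod c) | constructor]; assumption.
- destruct hn as [hA [hB hM]].
  hered IHA hA h1 h2 h3 A' rA nA tA lA.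
  hered IHB hB h1 h2 h3 B' rB nB tB lB.
  hered IHM hM h1 h2 h3 M' rM nM tM lM.
  exists (Cabs s1 s2 A' B' M'); repeat split; auto; [apply (cg_abs c) | constructor]; assumption.
- destruct hn as [hA [hB [hM hN]]].
  hered IHA hA h1 h2 h3 A' rA nA tA lA.
  hered IHB hB h1 h2 h3 B' rB nB tB lB.
  hered IHM hM h1 h2 h3 M' rM nM tM lM.
  hered IHN hN h1 h2 h3 N' rN nN tN lN.
  exists (Capp s1 s2 A' B' M' N'); repeat split; auto; [apply (cg_capp c) | constructor]; assumption.
Qed.

(** Once the subterms are normal, the only possible redex is at the root, and one hereditary
    substitution removes it. *)
Lemma styp_normalizes G M a : styp G M a -> exists N, dbetas M N /\ nf N /\ styp G N a.
Proof.
assert (c := congruence_rt (@beta_root P)).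
induction 1;
  repeat match goal with
  | H : exists N, dbetas _ N /\ _ |- _ => destruct H as [? [? [? ?]]]
  end;
  try (eexists; split;
    [first [apply (cg_lam c) | apply (cg_pi c) | apply (cg_El c) | apply (cg_Prod c)
           | apply (cg_abs c) | apply (cg_capp c)]; eassumption
    | split; [simpl; auto | econstructor; eassumption]]);
  try (eexists; split; [apply rt_refl | split; [exact I | econstructor; eassumption]]).
destruct (is_lam x0) eqn:e.
- destruct x0 as [| | | |A M'| | | | | | |]; try discriminate.
  match goal with H : styp _ (DLam _ _) _, n : nf (DLam _ _) |- _ =>
    inversion H; subst; destruct n as [_ n] end.
  (* Only index 0, of type [a], can be replaced by an abstraction; this gives the bound
     [tsize a]. *)
  match goal with H : styp (scons a G) M' b, n : nf M' |- _ =>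
    destruct (@nf_inst (tsize a) _ _ _ H n G (scons x (@DVar P)))
      as [Q [rQ [nQ [tQ _]]]] end.
  + intros [|y]; simpl; [assumption | constructor; reflexivity].
  + intros [|y]; simpl; auto.
  + intros [|y]; simpl; [auto | discriminate].
  + exists Q; repeat split; auto.
    eapply rt_trans; [apply (cg_app c); eassumption|].
    eapply rt_trans; [apply rt_step; constructor; constructor|].
    rewrite dsubst0E; assumption.
- exists (DApp x0 x); repeat split; auto; [apply (cg_app c) | econstructor]; eassumption.
Qed.

(** * Normalization of typable terms in translated contexts *)

Lemma dtyp_normalizes D M T : dtyp D M T -> Forall (lev Fam) D ->
  exists N, dbetas M N /\ beta_normal N.
Proof.
intros hM hD.
(* [base] is a default for indices beyond the context, on which [hG] imposes nothing. *)
set (G := fun x => match nth_error D x with Some A => erase A | None => base end).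
assert (hG : forall x A, nth_error D x = Some A -> G x = erase A).
{ intros x A hx; unfold G; rewrite hx; reflexivity. }
destruct (styp_normalizes (dtyp_styp hM hD hG)) as [N [r [hN _]]].
exists N; split; [assumption | apply nf_beta_normal; assumption].
Qed.

Lemma lev_trans (e : eterm P) : lev Obj (trans e).
Proof. induction e; simpl; repeat constructor; try assumption; discriminate. Qed.

Lemma lev_trans_ctx G D : trans_ctx G D -> Forall (lev Fam) D.
Proof. induction 1; repeat constructor; auto using lev_trans. Qed.

Lemma nf_trans (e : eterm P) : nf (trans e).
Proof. induction e; simpl; auto. Qed.

End Levels.

(** * Assembly of the bijection and the remaining claims *)

Theorem mainTheorem4 (P : pts) (hP : functional P) :
  (forall (G : list (eterm P)) (A : eterm P) (D : list (dterm P)) (T : dterm P),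
     eistype G A -> trans_ctx G D -> trans_type G A T ->
     bijection_mod
       (fun M => etyp G M A)
       (fun M => dtyp D M T /\ beta_normal M)
       (@H_equiv P) (@trans P) (@inv P)
     /\ (forall M, dtyp D M T -> exists N, dbetas M N /\ beta_normal N))
  /\ (forall (x : nat) (M N : eterm P),
        dsubst x (trans N) (trans M) = trans (esubst x N M))
  /\ (forall M N : eterm P, ereds M N <-> dreds (trans M) (trans N)).
Proof.
split; [|split; [exact (@trans_subst P) | exact (@ereds_iff_dreds P)]].
intros G A D T hA hD hT.
assert (wf : ewf G).
{ destruct hA as [[s h]|[s [_ [_ h]]]]; [eapply etyp_wf; eassumption | assumption]. }
assert (hrep : represents_type G A T).
{ destruct hT as [s _|A s h]; [apply represents_U | apply represents_El; auto using dconv_refl]. }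
(* Conservativity restated through the function [inv]: it provides both the inverse image of a
   normal term and the H-equivalence of the round trip. *)
assert (hcons : forall M, dtyp D M T /\ beta_normal M ->
  exists e, inv M = Some e /\ etyp G e A /\ H_equiv (trans e) M).
{ intros M [hM hn].
  destruct (normal_conservative hP (le_n _) (conv_ctx_trans_ctx hD) wf hn hM hrep)
    as [e [h1 h2]].
  exists e; split; [apply invertible_inv|]; assumption. }
split; [|intros M hM; apply (dtyp_normalizes hM (lev_trans_ctx hD))].
repeat split.
- eapply trans_sound; eassumption.
- apply nf_beta_normal, nf_trans.
- intros M hM; destruct (hcons M hM) as [e [h1 [h2 _]]]; eauto.
- intros M M' _ _; apply inv_H_equiv.
- intros e _; apply inv_trans.
- intros M e hM he; destruct (hcons M hM) as [e' [h1 [_ h2]]].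
  replace e with e' by congruence; assumption.
Qed.
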